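(* Let $T$ be a spherically homogeneous rooted tree in which every vertex has at least $2$ children, and let $G\le \mathrm{Aut}~T$ be a finitely generated branch group. Then $G$ does not have the local retraction property $\mathrm{(LR)}$.
   Context: $\mathrm{Aut}~T$ is the group of automorphisms of $T$ fixing the root. The $n$th level $\mathcal{L}_n$ is the set of vertices at distance $n$ from the root. For a vertex $v$, $T_v$ is the subtree of descendants of $v$ (including $v$). For $G\le\mathrm{Aut}~T$, the rigid vertex stabilizer $\mathrm{rist}_G(v)$ is the subgroup of elements of $G$ fixing every vertex not in $T_v$, and the rigid level stabilizer is $\mathrm{Rist}_G(n)=\prod_{v\in\mathcal{L}_n}\mathrm{rist}_G(v)$ (an internal direct product). $G$ is level-transitive if it acts transitively on every level $\mathcal{L}_n$. $G$ is branch if it is level-transitive and $\mathrm{Rist}_G(n)$ has finite index in $G$ for every $n\ge1$. A subgroup $H\le G$ is a virtual retract of $G$ if there is a finite-index subgroup $K\le G$ containing $H$ and a homomorphism $K\to H$ restricting to the identity on $H$. $G$ has property $\mathrm{(LR)}$ if every finitely generated subgroup of $G$ is a virtual retract of $G$. *)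

(* Defs.v *)
From Stdlib Require List.
From mathcomp Require Import all_boot.
Set Implicit Arguments. Unset Strict Implicit. Unset Printing Implicit Defensive.

(* The spherically homogeneous rooted tree T with branching sequence m:
   vertices at level n are words w = [w_0; ...; w_{n-1}] with w_i < m i;
   the root is [::], the children of w are rcons w a (a < m (size w)),
   and T_v consists of the words having v as a prefix. *)
Definition vertex (m : nat -> nat) (w : seq nat) : bool :=
  all (fun i => nth 0 w i < m i) (iota 0 (size w)).

Definition perm_fun := seq nat -> seq nat.

Definition in_subtree (v w : seq nat) : bool := take (size v) w == v.

(* Automorphisms of T fixing the root, represented as functions on words
   that act as the identity outside the vertex set (so that equality of
   automorphisms is extensional equality). *)
Definition is_aut (m : nat -> nat) (f : perm_fun) : Prop :=
  [/\ (forall w, vertex m w -> vertex m (f w) /\ size (f w) = size w),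
      (forall w k, vertex m w -> f (take k w) = take k (f w)),
      (forall u w, vertex m u -> vertex m w -> f u = f w -> u = w),
      (forall u, vertex m u -> exists w, vertex m w /\ f w = u)
    & (forall w, ~~ vertex m w -> f w = w)].

Definition mulf (g h : perm_fun) : perm_fun := fun x => g (h x).
Definition idf : perm_fun := fun x => x.

Definition subset (A B : perm_fun -> Prop) : Prop := forall g, A g -> B g.

Definition is_subgroup (m : nat -> nat) (H : perm_fun -> Prop) : Prop :=
  [/\ subset H (is_aut m), H idf,
      (forall g h, H g -> H h -> H (mulf g h))
    & (forall g, H g -> exists h, H h /\ mulf h g = idf /\ mulf g h = idf)].

Definition gen (m : nat -> nat) (S : perm_fun -> Prop) : perm_fun -> Prop :=
  fun g => forall H, is_subgroup m H -> subset S H -> H g.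

Definition fin_gen (m : nat -> nat) (H : perm_fun -> Prop) : Prop :=
  exists s : list perm_fun, forall g, H g <-> gen m (fun x => List.In x s) g.

Definition finite_index (m : nat -> nat) (K G : perm_fun -> Prop) : Prop :=
  is_subgroup m K /\ subset K G /\
  exists reps : list perm_fun,
    (forall r, List.In r reps -> G r) /\
    forall g, G g -> exists r k, List.In r reps /\ K k /\ g = mulf r k.

Definition rist (m : nat -> nat) (G : perm_fun -> Prop) (v : seq nat)
  : perm_fun -> Prop :=
  fun g => G g /\ forall w, vertex m w -> ~~ in_subtree v w -> g w = w.

(* rigid level stabilizer: the (internal, direct) product of the rist_G(v),
   v in level n, i.e. the subgroup they generate *)
Definition Rist (m : nat -> nat) (G : perm_fun -> Prop) (n : nat)
  : perm_fun -> Prop :=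
  gen m (fun g => exists v, [/\ vertex m v, size v = n & rist m G v g]).

Definition level_transitive (m : nat -> nat) (G : perm_fun -> Prop) : Prop :=
  forall u w, vertex m u -> vertex m w -> size u = size w ->
    exists g, G g /\ g u = w.

Definition is_branch (m : nat -> nat) (G : perm_fun -> Prop) : Prop :=
  level_transitive m G /\ forall n, 1 <= n -> finite_index m (Rist m G n) G.

Definition virtual_retract (m : nat -> nat) (H G : perm_fun -> Prop) : Prop :=
  exists K : perm_fun -> Prop, finite_index m K G /\ subset H K /\
  exists phi : perm_fun -> perm_fun,
    [/\ (forall x y, K x -> K y -> phi (mulf x y) = mulf (phi x) (phi y)),
        (forall x, K x -> H (phi x))
      & (forall h, H h -> phi h = h)].

Definition has_LR (m : nat -> nat) (G : perm_fun -> Prop) : Prop :=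
  forall H, is_subgroup m H -> subset H G -> fin_gen m H ->
    virtual_retract m H G.

(* Main.v *)
Require Import Defs.
From mathcomp Require Import all_boot.
From Stdlib Require Import FunctionalExtensionality Classical ClassicalEpsilon.
From Stdlib Require List.
Set Implicit Arguments. Unset Strict Implicit. Unset Printing Implicit Defensive.

(* Let phi : K -> H be a retraction onto a subgroup H of infinite index. Some
   g <> 1 in ker phi moves a vertex u, arbitrarily deep, and then phi kills the
   commutators of rist_K(u), because x and its conjugate by g have the same
   image and the latter commutes with rist_K(u); as G is branch, rist_K(u) is
   not abelian. So it suffices to find a finitely generated H of infinite index
   that catches enough of these commutators c.

   If G has torsion, take s in G of prime order p moving vertices of level n,
   and let H be generated by s, by rist_G(v) for the v of level n fixed by s, and
   by the products of the s-conjugates of c for c in rist_G(v), v moved by s. If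
   phi c = 1 then phi maps the product (s c)^p of the conjugates of c to
   s^p = 1. The index is infinite: on the vertices moved by s,
   elements of H commute with s, so H meets rist_G(v) trivially if s moves v.

   Otherwise some g1 in rist_G(v1) has infinite order; let g2 in rist_G(v2) be a
   conjugate of it. By (LR) both <gi> are retracts of finite-index subgroups Ki.
   Let H be the product of the rist_G(w), w <> v1, v2 on the level of v1, and of
   the fibre product of rist_K1(v1) and rist_K2(v2) over <g1> = <g2>: it is
   finitely generated, contains the commutators of the rist_Ki(vi), and meets
   <g1> trivially. *)

(** * Choice along finite lists, and inverses *)

Lemma list_choice T U (P : T -> U -> Prop) (l : list T) :
  (forall x, List.In x l -> exists y, P x y) ->
  exists l', (forall x, List.In x l -> exists y, List.In y l' /\ P x y) /\
             (forall y, List.In y l' -> exists x, List.In x l /\ P x y).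
Proof.
elim: l => [|a l IHl] lP; first by exists nil.
have [y ay] := lP a (or_introl erefl).
have [l' [l'P l'Q]] := IHl (fun x lx => lP x (or_intror lx)).
exists (y :: l'); split=> [x [<-|/l'P[z [l'z xz]]]|z [<-|/l'Q[x [lx xz]]]].
- by exists y; split=> //; left.
- by exists z; split=> //; right.
- by exists a; split=> //; left.
- by exists x; split=> //; right.
Qed.

Lemma list_filter T (P : T -> Prop) (l : list T) :
  exists l', forall x, List.In x l' <-> List.In x l /\ P x.
Proof.
elim: l => [|a l [l' l'P]]; first by exists nil => x; split=> [|[]].
have [Pa|nPa] := classic (P a).
  exists (a :: l') => x; split=> [[<-|/l'P[]]|[[<-|lx] Px]] /=; try tauto.
  by right; apply/l'P.
exists l' => x; split=> [/l'P[]|[[<-|lx] Px]] /=; try tauto.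
by apply/l'P.
Qed.

Lemma list_In_map (T : Type) (U : eqType) (f : T -> U) x (l : list T) :
  List.In x l -> f x \in List.map f l.
Proof.
by elim: l => //= a l IHl [->|/IHl fx]; rewrite in_cons ?eqxx ?fx ?orbT.
Qed.

(** [is_subgroup] only asserts that inverses exist; [epsilon] turns this into one total function
    that serves all subgroups at once. *)
Definition invf (g : perm_fun) : perm_fun :=
  epsilon (inhabits idf) (fun h => mulf h g = idf /\ mulf g h = idf).

Lemma invf_eq g h : mulf h g = idf -> mulf g h = idf -> invf g = h.
Proof.
move=> hg gh.
have [ig _] : mulf (invf g) g = idf /\ mulf g (invf g) = idf.
  exact: (epsilon_spec _ (fun h => mulf h g = idf /\ mulf g h = idf)
            (ex_intro _ h (conj hg gh))).
apply: functional_extensionality => w.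
by rewrite -[w in LHS](equal_f gh w); apply: (equal_f ig (h w)).
Qed.

(** * Subgroups, generation and finite index *)

Section Subgroups.
Context (m : nat -> nat).
Implicit Types (A G H K : perm_fun -> Prop) (g h x y : perm_fun).

Lemma sub_aut A g : is_subgroup m A -> A g -> is_aut m g.
Proof. by case=> + _ _ _; apply. Qed.

Lemma sub1 A : is_subgroup m A -> A idf. Proof. by case. Qed.

Lemma subM A x y : is_subgroup m A -> A x -> A y -> A (mulf x y).
Proof. by case=> _ _ + _; apply. Qed.

Lemma subV A g : is_subgroup m A -> A g -> A (invf g).
Proof. by case=> _ _ _ /[apply] -[h [Ah [hg gh]]]; rewrite (invf_eq hg gh). Qed.

Lemma invfK A g : is_subgroup m A -> A g -> cancel g (invf g).
Proof.
case=> _ _ _ /[apply] -[h [Ah [hg gh]]] w.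
by rewrite (invf_eq hg gh); apply: (equal_f hg).
Qed.

Lemma invfKV A g : is_subgroup m A -> A g -> cancel (invf g) g.
Proof.
case=> _ _ _ /[apply] -[h [Ah [hg gh]]] w.
by rewrite (invf_eq hg gh); apply: (equal_f gh).
Qed.

Lemma mulVf A g : is_subgroup m A -> A g -> mulf (invf g) g = idf.
Proof. by move=> sA Ag; apply: functional_extensionality => w; exact: invfK Ag _. Qed.

Lemma mulfV A g : is_subgroup m A -> A g -> mulf g (invf g) = idf.
Proof. by move=> sA Ag; apply: functional_extensionality => w; exact: invfKV Ag _. Qed.

Lemma invf1 : invf idf = idf. Proof. exact: invf_eq. Qed.

Lemma invfV A g : is_subgroup m A -> A g -> invf (invf g) = g.
Proof. by move=> sA Ag; apply: invf_eq; [exact: mulfV Ag|exact: mulVf Ag]. Qed.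

Lemma invfM A x y : is_subgroup m A -> A x -> A y ->
  invf (mulf x y) = mulf (invf y) (invf x).
Proof.
move=> sA Ax Ay; apply: invf_eq; apply: functional_extensionality => w.
  by rewrite /mulf (invfK sA Ax) (invfK sA Ay).
by rewrite /mulf (invfKV sA Ay) (invfKV sA Ax).
Qed.

Lemma mulfI A g x y : is_subgroup m A -> A g -> mulf g x = mulf g y -> x = y.
Proof.
move=> sA Ag /(congr1 (mulf (invf g))) E; apply: functional_extensionality => w.
by have := equal_f E w; rewrite /mulf !(invfK sA Ag).
Qed.

Lemma sub_iter A g j : is_subgroup m A -> A g -> A (iter j g).
Proof. by move=> sA Ag; elim: j => [|j IHj]; [exact: sub1|exact: subM sA Ag IHj]. Qed.

Lemma is_subgroup_sub A H : is_subgroup m A -> (forall x, H x -> A x) -> H idf ->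
  (forall x y, H x -> H y -> H (mulf x y)) -> (forall x, H x -> H (invf x)) ->
  is_subgroup m H.
Proof.
move=> sA HA H1 HM HV; split=> // [g /HA|g Hg]; first exact: sub_aut.
by exists (invf g); rewrite (mulVf sA (HA _ Hg)) (mulfV sA (HA _ Hg)); auto.
Qed.

Lemma gen_in S g : S g -> gen m S g. Proof. by move=> Sg H _; apply. Qed.

Lemma gen_sub A S g : is_subgroup m A -> (forall x, S x -> A x) -> gen m S g -> A g.
Proof. by move=> sA SA; apply. Qed.

Lemma gen_subgroup A S : is_subgroup m A -> (forall x, S x -> A x) ->
  is_subgroup m (gen m S).
Proof.
move=> sA SA; apply: (is_subgroup_sub sA).
- by move=> x; apply: gen_sub.
- by move=> H sH _; exact: sub1 sH.
- by move=> x y Sx Sy H sH SH; exact: (subM sH (Sx _ sH SH) (Sy _ sH SH)).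
- by move=> x Sx H sH SH; exact: (subV sH (Sx _ sH SH)).
Qed.

(** The elements of [A] satisfying [P] form a subgroup containing [S]. *)
Lemma gen_ind A S (P : perm_fun -> Prop) : is_subgroup m A ->
  (forall x, S x -> A x) -> P idf -> (forall x, S x -> P x) ->
  (forall x y, A x -> A y -> P x -> P y -> P (mulf x y)) ->
  (forall x, A x -> P x -> P (invf x)) -> forall g, gen m S g -> P g.
Proof.
move=> sA SA P1 SP PM PV g Sg.
suff [] : A g /\ P g by [].
apply: (gen_sub (A := fun g => A g /\ P g)) Sg; last by move=> x Sx; split; auto.
apply: (is_subgroup_sub sA) => [x []//||x y [Ax Px] [Ay Py]|x [Ax Px]].
- by split=> //; exact: sub1 sA.
- by split; [exact: subM|exact: PM].
- by split; [exact: subV|exact: PV].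
Qed.

Lemma fin_gen_gens H : is_subgroup m H -> fin_gen m H ->
  exists s, (forall x, List.In x s -> H x) /\ (forall g, H g -> gen m (fun x => List.In x s) g).
Proof.
move=> sH [s sP]; exists s; split=> g; last by move/sP.
by move=> sg; apply/sP; exact: gen_in.
Qed.

Lemma gens_fin_gen H s : is_subgroup m H -> (forall x, List.In x s -> H x) ->
  (forall g, H g -> gen m (fun x => List.In x s) g) -> fin_gen m H.
Proof. by move=> sH sP sG; exists s => g; split=> [/sG//|]; exact: gen_sub. Qed.

Lemma fin_gen_list A s : is_subgroup m A -> (forall x, List.In x s -> A x) ->
  fin_gen m (gen m (fun x => List.In x s)).
Proof. by move=> sA sP; exists s. Qed.

Lemma subgroupI A H : is_subgroup m A -> is_subgroup m H ->
  is_subgroup m (fun g => A g /\ H g).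
Proof.
move=> sA sH; apply: (is_subgroup_sub sA) => [x []//||x y [Ax Hx] [Ay Hy]|x [Ax Hx]].
- by split; [exact: sub1 sA|exact: sub1 sH].
- by split; [exact: subM sA Ax Ay|exact: subM sH Hx Hy].
- by split; [exact: subV sA Ax|exact: subV sH Hx].
Qed.

(** Schreier's argument: for each generator or inverse [x] and each representative [r], write
    [x r = r' k] with [k] in [K]. These finitely many [k], together with the representatives lying
    in [K], generate [K]. *)
Lemma schreier G K : is_subgroup m G -> fin_gen m G -> finite_index m K G ->
  fin_gen m K.
Proof.
move=> sG /(fin_gen_gens sG)[s [sP sgen]] [sK [KG [reps [repG repP]]]].
pose P (xr rk : perm_fun * perm_fun) :=
  [/\ List.In rk.1 reps, K rk.2 & mulf xr.1 xr.2 = mulf rk.1 rk.2].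
have sVG x : List.In x (s ++ List.map invf s) -> G x.
  by case/List.in_app_iff => [/sP//|/List.in_map_iff[y [<- /sP]]]; apply: subV.
have PP xr : List.In xr (List.list_prod (s ++ List.map invf s) reps) ->
    exists rk, P xr rk.
  case: xr => x r /List.in_prod_iff[sx rr].
  have [r' [k [rr' [Kk E]]]] := repP _ (subM sG (sVG _ sx) (repG _ rr)).
  by exists (r', k).
have [l [lP lQ]] := list_choice PP.
have [rK rKP] := list_filter K reps.
pose t := List.map snd l ++ rK.
have tK x : List.In x t -> K x.
  case/List.in_app_iff => [/List.in_map_iff[rk [<- /lQ[xr [_ []]]]]//|].
  by case/rKP.
have sM : is_subgroup m (gen m (fun x => List.In x t)) := gen_subgroup sK tK.
(* The union [U] of the cosets [r M], where [M] is generated by [t], is stable under left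
   multiplication by [G]; since it contains 1, it contains [G]. *)
pose U g := exists r k,
  [/\ List.In r reps, gen m (fun x => List.In x t) k & g = mulf r k].
have US x u : List.In x (s ++ List.map invf s) -> U u -> U (mulf x u).
  move=> sx [r [k [rr tk ->]]].
  have [|[r' k'] [lrk [/= rr' Kk' E]]] := lP (x, r); first exact/List.in_prod_iff.
  exists r', (mulf k' k); split=> //; last by rewrite -[RHS]/(mulf (mulf r' k') k) -E.
  apply: (subM sM) => //; apply: gen_in; apply/List.in_app_iff; left.
  by apply/List.in_map_iff; exists (r', k').
have UG g : G g -> forall u, U u -> U (mulf g u).
  move=> /sgen sg; suff [] : (forall u, U u -> U (mulf g u)) /\
    (forall u, U u -> U (mulf (invf g) u)) by [].
  apply: (gen_ind (P := fun g => (forall u, U u -> U (mulf g u)) /\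
    (forall u, U u -> U (mulf (invf g) u))) sG sP _ _ _ _ sg).
  - by rewrite invf1.
  - move=> x sx; split=> u; apply: US; apply/List.in_app_iff; first by left.
    by right; apply/List.in_map_iff; exists x.
  - move=> x y Gx Gy [xU xVU] [yU yVU]; rewrite (invfM sG Gx Gy).
    by split=> u Uu; [exact: xU (yU _ Uu)|exact: yVU (xVU _ Uu)].
  - by move=> x Gx []; rewrite (invfV sG Gx); split.
have inK r : List.In r reps -> K r -> gen m (fun x => List.In x t) r.
  by move=> rr Kr; apply: gen_in; apply/List.in_app_iff; right; apply/rKP.
(* The list [reps] may miss 1, but [1 = r k] puts [r] in [K], so [k] is the inverse of an element of
   [t]. *)
have U1 : U idf.
  have [r [k [rr [Kk E]]]] := repP _ (sub1 sG).
  have Ek : invf k = r.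
    by apply: functional_extensionality => w; rewrite -[RHS]/(r w) -{2}[w](invfKV sK Kk) -[RHS](equal_f E).
  have Er : invf r = k by rewrite -Ek (invfV sK Kk).
  exists r, k; split=> //; rewrite -Er; apply: (subV sM); apply: inK => //.
  by rewrite -Ek; exact: (subV sK Kk).
apply: (gens_fin_gen sK tK) => g Kg.
have [r [k [rr Mk E]]] : U g by apply: (UG g _ _ U1); apply: KG.
rewrite E; apply: (subM sM) => //; apply: inK => //.
have Kk : K k := gen_sub sK tK Mk.
suff -> : r = mulf g (invf k) by exact: (subM sK Kg (subV sK Kk)).
by rewrite E; apply: functional_extensionality => w; rewrite /mulf (invfKV sK Kk).
Qed.

(** For every coset [r K] that meets [A], one element of the intersection serves as
    representative. *)
Lemma finite_indexI G A K : is_subgroup m A -> (forall g, A g -> G g) ->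
  is_subgroup m G -> finite_index m K G -> finite_index m (fun g => A g /\ K g) A.
Proof.
move=> sA AG sG [sK [KG [reps [repG repP]]]].
split; first exact: subgroupI.
split=> [g []//|].
have [l lP] := list_filter (fun r => exists a k, [/\ A a, K k & a = mulf r k]) reps.
have lPP r : List.In r l -> exists a, A a /\ exists2 k, K k & a = mulf r k.
  by case/lP => _ [a [k [Aa Kk E]]]; exists a; split=> //; exists k.
have [l' [l'P l'Q]] := list_choice lPP.
exists l'; split=> [a /l'Q[r [_ []]]//|g Ag].
have [r [k [rr [Kk E]]]] := repP g (AG _ Ag).
have [|a [la [Aa [k' Kk' E']]]] := l'P r; first by apply/lP; split=> //; exists g, k.
exists a, (mulf (invf a) g); split=> //; split; last first.
  by apply: functional_extensionality => w; rewrite /mulf (invfKV sA Aa).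
split; first exact: (subM sA (subV sA Aa) Ag).
have Gr := repG _ rr.
have -> : mulf (invf a) g = mulf (invf k') k; last exact: (subM sK (subV sK Kk') Kk).
rewrite E' E (invfM sG Gr (KG _ Kk')).
by apply: functional_extensionality => w; rewrite /mulf (invfK sG Gr).
Qed.

Lemma finite_index_trans G A K : is_subgroup m G ->
  finite_index m A G -> finite_index m K A -> finite_index m K G.
Proof.
move=> sG [sA [AG [l1 [l1G l1P]]]] [sK [KA [l2 [l2A l2P]]]].
split=> //; split=> [g /KA/AG//|].
exists (List.map (fun p => mulf p.1 p.2) (List.list_prod l1 l2)); split.
  move=> r /List.in_map_iff[[r1 r2] [<- /List.in_prod_iff[/l1G r1G /l2A/AG r2G]]].
  exact: (subM sG r1G r2G).
move=> g /l1P[r1 [a [lr1 [/l2P[r2 [k [lr2 [Kk ->]]]] ->]]]].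
exists (mulf r1 r2), k; split=> //.
by apply/List.in_map_iff; exists (r1, r2); split=> //; apply/List.in_prod_iff.
Qed.

Lemma pigeonhole G K (x : nat -> perm_fun) : is_subgroup m G ->
  finite_index m K G -> (forall i, G (x i)) ->
  exists i j, i < j /\ K (mulf (invf (x i)) (x j)).
Proof.
move=> sG [sK [KG [reps [repG repP]]]] xG.
have E i : exists r, r < length reps /\ exists2 k, K k & x i = mulf (List.nth r reps idf) k.
  have [r [k [rr [Kk ->]]]] := repP _ (xG i).
  have [n [/ltP nl <-]] := List.In_nth reps r idf rr.
  by exists n; split=> //; exists k.
(* Maps carry no decidable equality, so cosets are counted through positions in [reps]. *)
pose f i := epsilon (inhabits 0) (fun r =>
  r < length reps /\ exists2 k, K k & x i = mulf (List.nth r reps idf) k).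
have fP i : f i < length reps /\ exists2 k, K k & x i = mulf (List.nth (f i) reps idf) k.
  exact: (epsilon_spec _ (fun r => r < length reps /\ exists2 k, K k &
    x i = mulf (List.nth r reps idf) k) (E i)).
pose F (i : 'I_(length reps).+1) : 'I_(length reps) := Ordinal (fP i).1.
have [i [j [ltij Fij]]] : exists i j : 'I_(length reps).+1, i < j /\ f i = f j.
  apply: NNPP => nE.
  suff /leq_card : injective F by rewrite !card_ord ltnn.
  move=> i j /(congr1 val) /= fij; apply: val_inj => /=.
  by case: (ltngtP i j) => // ltij; case: nE; [exists i, j|exists j, i].
exists i, j; split=> //.
have [_ [ki Kki ->]] := fP i; have [lj [kj Kkj ->]] := fP j; rewrite Fij.
have Gr : G (List.nth (f j) reps idf) by apply/repG/List.nth_In/ltP.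
rewrite (invfM sG Gr (KG _ Kki)).
have -> : mulf (mulf (invf ki) (invf (List.nth (f j) reps idf)))
               (mulf (List.nth (f j) reps idf) kj) = mulf (invf ki) kj.
  by apply: functional_extensionality => w; rewrite /mulf (invfK sG Gr).
exact: (subM sK (subV sK Kki) Kkj).
Qed.
End Subgroups.

(** * Vertices, subtrees and rigid stabilizers *)

Section Trees.
Context (m : nat -> nat).
Implicit Types (G H K : perm_fun -> Prop) (f g h x y : perm_fun).
Implicit Types (u v w : seq nat).

Lemma vertexP w : reflect (forall i, i < size w -> nth 0 w i < m i) (vertex m w).
Proof.
apply: (iffP allP) => [mw i iw|mw i]; last by rewrite mem_iota add0n => /andP[_ /mw].
by apply: mw; rewrite mem_iota add0n.
Qed.

Lemma vertex_take k w : vertex m w -> vertex m (take k w).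
Proof.
move=> /vertexP mw; apply/vertexP => i; rewrite size_take_min ltn_min => /andP[ik iw].
by rewrite nth_take ?mw.
Qed.

Lemma vertex_cat u t : (forall n, 2 <= m n) -> vertex m u ->
  all (fun a => a < 2) t -> vertex m (u ++ t).
Proof.
move=> hm /vertexP mu /(all_nthP 0) t2; apply/vertexP => i; rewrite size_cat nth_cat.
move=> it; case: (ltnP i (size u)) => [ui|ui]; first exact: mu.
apply: leq_trans (hm i).
by apply: t2; rewrite ltn_subLR.
Qed.

Lemma in_subtree_cat v t : in_subtree v (v ++ t).
Proof. by rewrite /in_subtree take_size_cat. Qed.

Lemma in_subtree_size v w : in_subtree v w -> size v <= size w.
Proof. by move=> /eqP E; rewrite -{1}E size_take_min geq_minr. Qed.

Lemma in_subtree_trans u v w : in_subtree u v -> in_subtree v w -> in_subtree u w.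
Proof.
move=> uv /eqP vw; have luv := in_subtree_size uv.
by move: uv; rewrite /in_subtree -{1}vw take_takel.
Qed.

Lemma in_subtree_comparable u v w : size u <= size v ->
  in_subtree u w -> in_subtree v w -> in_subtree u v.
Proof. by move=> luv /eqP uw /eqP vw; rewrite /in_subtree -{1}vw take_takel // uw. Qed.

Lemma in_subtree_eq u v : size u = size v -> in_subtree u v -> u = v.
Proof. by move=> luv /eqP; rewrite luv take_size. Qed.

Lemma in_subtree_disjoint u v w : size u = size v -> u != v ->
  in_subtree u w -> ~~ in_subtree v w.
Proof.
move=> luv neq uw; apply: contraNN neq => vw.
by apply/eqP/in_subtree_eq => //; apply: in_subtree_comparable uw vw; rewrite luv.
Qed.

Lemma aut_size f w : is_aut m f -> size (f w) = size w.
Proof.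
case=> fV _ _ _ f1; have [/fV[]//|nw] := boolP (vertex m w).
by rewrite f1.
Qed.

Lemma aut_vertex f w : is_aut m f -> vertex m (f w) = vertex m w.
Proof.
case=> fV _ _ _ f1; have [/fV[]//|nw] := boolP (vertex m w).
by rewrite f1 // (negPf nw).
Qed.

Lemma aut_take f k w : is_aut m f -> vertex m w -> take k (f w) = f (take k w).
Proof. by case=> _ fT _ _ _ vw; rewrite fT. Qed.

Lemma aut_inj f : is_aut m f -> injective f.
Proof.
move=> fA u w E; have [_ _ fI _ f1] := fA.
have vuw : vertex m u = vertex m w by rewrite -(aut_vertex u fA) E aut_vertex.
have [vu|nu] := boolP (vertex m u); first by apply: fI; rewrite -?vuw.
by rewrite -(f1 u) // E f1 // -vuw.
Qed.

Lemma aut_subtree f v w : is_aut m f -> vertex m w ->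
  in_subtree (f v) (f w) = in_subtree v w.
Proof.
by move=> fA vw; rewrite /in_subtree aut_size // aut_take // (inj_eq (aut_inj fA)).
Qed.

Lemma aut_ext f g : is_aut m f -> is_aut m g ->
  (forall w, vertex m w -> f w = g w) -> f = g.
Proof.
case=> _ _ _ _ f1 [_ _ _ _ g1] fg; apply: functional_extensionality => w.
by have [/fg//|nw] := boolP (vertex m w); rewrite f1 ?g1.
Qed.

Lemma aut_moves g : is_aut m g -> g <> idf -> exists2 w, vertex m w & g w <> w.
Proof.
case=> _ _ _ _ g1 gN1; apply: NNPP => nE; apply: gN1.
apply: functional_extensionality => w; have [vw|/g1//] := boolP (vertex m w).
by apply: NNPP => gw; case: nE; exists w.
Qed.

Section Subgroup.
Context (G : perm_fun -> Prop) (sG : is_subgroup m G).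

Let Gaut g : G g -> is_aut m g. Proof. exact: sub_aut. Qed.

Lemma rist_sub v g : rist m G v g -> G g. Proof. by case. Qed.

Lemma rist_subgroup v : is_subgroup m (rist m G v).
Proof.
apply: (is_subgroup_sub sG) => [x []//||x y [Gx x1] [Gy y1]|x [Gx x1]].
- by split=> //; apply: (sub1 sG).
- by split=> [|w vw nw]; [apply: (subM sG)|rewrite /mulf y1 // x1].
- by split=> [|w vw nw]; [apply: (subV sG)|rewrite -{1}(x1 w) // (invfK sG Gx)].
Qed.

(** Only [v] itself needs an argument: if [g v] differed from [v], it would lie outside the subtree
    of [v], so [g] would fix it, against injectivity. *)
Lemma rist_fix v g w : rist m G v g -> vertex m w -> size w <= size v -> g w = w.
Proof.
move=> [Gg g1] vw lwv; have [vinw|/g1->//] := boolP (in_subtree v w).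
have Evw : v = w.
  by apply: in_subtree_eq (vinw); apply/eqP; rewrite eqn_leq lwv in_subtree_size.
rewrite -Evw in vw *; apply: NNPP => gv.
have gA := Gaut Gg; case: (gv); apply: (aut_inj gA).
apply: g1; first by rewrite aut_vertex.
by apply: contra_notN gv => /in_subtree_eq E; rewrite -E ?aut_size.
Qed.

Lemma rist_subtree v g w : rist m G v g -> vertex m w ->
  in_subtree v (g w) = in_subtree v w.
Proof.
move=> rg vw; have gA := Gaut (rist_sub rg).
rewrite /in_subtree aut_take // (rist_fix rg) ?vertex_take //.
by rewrite size_take_min geq_minl.
Qed.

Lemma rist_mono v u g : in_subtree v u -> rist m G u g -> rist m G v g.
Proof.
move=> vu [Gg g1]; split=> // w vw nw; apply: g1 => //.
by apply: contraNN nw; apply: in_subtree_trans.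
Qed.

Lemma rist_conj v g x : vertex m v -> G g -> rist m G v x ->
  rist m G (g v) (mulf g (mulf x (invf g))).
Proof.
move=> vv Gg [Gx x1]; split=> [|w vw nw].
  by apply: (subM sG Gg); apply: (subM sG Gx); apply: (subV sG).
rewrite /mulf x1 ?(invfKV sG Gg) //; first by rewrite aut_vertex //; apply/Gaut/(subV sG).
apply: contraNN nw; rewrite -(aut_subtree _ (Gaut Gg)) ?(invfKV sG Gg) //.
by rewrite aut_vertex //; apply/Gaut/(subV sG).
Qed.

Lemma rist_commute u v x y : (forall w, in_subtree u w -> ~~ in_subtree v w) ->
  rist m G u x -> rist m G v y -> mulf x y = mulf y x.
Proof.
move=> uv rx ry; apply: aut_ext.
- by apply/Gaut/(subM sG); apply: rist_sub; eassumption.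
- by apply/Gaut/(subM sG); apply: rist_sub; eassumption.
move=> w vw; rewrite /mulf; have [uw|nuw] := boolP (in_subtree u w).
  by rewrite !(proj2 ry) ?uv ?(rist_subtree rx) // aut_vertex //; apply/Gaut/rist_sub/rx.
rewrite !(proj2 rx) // ?aut_vertex //; first by apply/Gaut/rist_sub/ry.
have [vw'|nvw] := boolP (in_subtree v w); last by rewrite (proj2 ry).
by apply: contraTN vw' => /uv; rewrite (rist_subtree ry).
Qed.

Lemma rist_disjoint u v x : (forall w, in_subtree u w -> ~~ in_subtree v w) ->
  rist m G u x -> rist m G v x -> x = idf.
Proof.
move=> uv [Gx xu] [_ xv]; apply: aut_ext => [||w vw].
- exact: Gaut.
- exact: Gaut (sub1 sG).
by have [/uv/xv->//|/xu->//] := boolP (in_subtree u w).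
Qed.
End Subgroup.

Lemma in_subtree_nth v w i : in_subtree v w -> i < size v -> nth 0 w i = nth 0 v i.
Proof. by move=> /eqP vw iv; rewrite -[in RHS]vw nth_take. Qed.

(** The vertices [u 0^i 1] branch off the ray [u 0 0 ...] and so root infinitely many disjoint
    subtrees below [u]: for [i < j] their letters at position [size u + i] differ. *)
Lemma comb_disjoint u i j w : in_subtree (u ++ nseq i 0 ++ [:: 1]) w ->
  in_subtree (u ++ nseq j 0 ++ [:: 1]) w -> i = j.
Proof.
wlog ij : i j / i < j => [hw iw jw|].
  by case: (ltngtP i j) => // ltij; [exact: hw|symmetry; exact: hw].
move=> /in_subtree_nth iw /in_subtree_nth jw.
(* Past the end of the word [nth] returns 0, so the formula also covers [l > k]. *)
have E k l : nth 0 (u ++ nseq k 0 ++ [:: 1]) (size u + l) = (k == l).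
  rewrite nth_cat ltnNge leq_addr addKn nth_cat size_nseq /= nth_nseq.
  by case: (ltngtP l k) => [//|kl|->]; rewrite ?subnn // nth_default // subn_gt0.
have := iw (size u + i); have := jw (size u + i).
rewrite !size_cat !size_nseq !ltn_add2l !addn1 ltnSn ltnS (ltnW ij) !E eqxx gtn_eqF //.
by move=> /(_ isT)-> /(_ isT).
Qed.

(** * Rigid stabilizers in branch groups are nontrivial and nonabelian *)

Section Branch.
Context (hm : forall n, 2 <= m n) (G : perm_fun -> Prop) (sG : is_subgroup m G).
Context (hbr : is_branch m G).

(** If rist_G(u) were trivial, transitivity would make all rigid stabilizers of its level trivial.
    Then [Rist] is trivial and [G] finite, against transitivity on large levels. *)
Lemma rist_neq1 u : vertex m u -> 0 < size u -> exists2 x, rist m G u x & x <> idf.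
Proof.
move=> vu lu; apply: NNPP => nE; have [tr fi] := hbr.
have rist1 w x : vertex m w -> size w = size u -> rist m G w x -> x = idf.
  move=> vw lw rx; have [g [Gg gw]] := tr w u vw vu lw.
  have := rist_conj sG vw Gg rx; rewrite gw => rgx.
  apply: NNPP => xN1; apply: nE; exists (mulf g (mulf x (invf g))) => // E.
  apply: xN1; apply: functional_extensionality => v.
  apply: (aut_inj (sub_aut sG Gg)); have := equal_f E (g v).
  by rewrite /mulf (invfK sG Gg).
have [sR [_ [reps [_ repP]]]] := fi _ lu.
have Grep g : G g -> List.In g reps.
  move=> /repP[r [k [rr [Rk ->]]]]; suff -> : k = idf by [].
  apply: (gen_sub (A := fun k => k = idf)) Rk.
    apply: (is_subgroup_sub sG) => [x ->|//|x y -> -> //|x ->]; last exact: invf1.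
    exact: sub1 sG.
  by move=> x [v [vv lv rx]]; apply: rist1 rx.
(* The words [0^i 1], padded with zeros to the common length [length reps + 1]; for [i] up to
   [length reps] they outnumber [reps], which contains all of [G]. *)
pose z i := (nseq i 0 ++ [:: 1]) ++ nseq (length reps - i) 0.
have zV i : vertex m (z i).
  rewrite -[z i]cat0s; apply: vertex_cat => //.
  by rewrite !all_cat !all_nseq /= !orbT.
have zsize i : i <= length reps -> size (z i) = (length reps).+1.
  by move=> ir; rewrite !size_cat !size_nseq /= addn1 addSn subnKC.
have zI : injective z.
  move=> i j zij; apply: (@comb_disjoint [::] i j (z i)); first exact: in_subtree_cat.
  by rewrite zij; apply: in_subtree_cat.
have /uniq_leq_size : uniq (map z (iota 0 (length reps).+1)).
  by rewrite map_inj_uniq // iota_uniq.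
move=> /(_ (List.map (fun g => g (z 0)) reps)).
rewrite size_map size_iota -[size (List.map _ _)]/(length _) List.length_map ltnn.
suff h : {subset map z (iota 0 (length reps).+1) <= List.map (fun g => g (z 0)) reps}.
  by move=> /(_ h).
move=> w /mapP[i]; rewrite mem_iota add0n ltnS => /andP[_ ir] ->.
have [|g [/Grep rg <-]] := tr (z 0) (z i) (zV 0) (zV i); first by rewrite !zsize.
exact: (list_In_map (fun g => g (z 0))).
Qed.

(** Take nontrivial elements of [G] supported below infinitely many disjoint vertices under [u]. Two
    of them lie in one left coset of [K]; their quotient is not 1, because the supports are
    disjoint. *)
Lemma ristK_neq1 K u : finite_index m K G -> vertex m u -> 0 < size u ->
  exists2 x, rist m K u x & x <> idf.
Proof.
move=> fK vu lu; pose z i := u ++ nseq i 0 ++ [:: 1].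
have zV i : vertex m (z i).
  by apply: vertex_cat => //; rewrite all_cat all_nseq /= orbT.
have zl i : 0 < size (z i) by rewrite size_cat ltn_addr.
pose x i := epsilon (inhabits idf) (fun x => rist m G (z i) x /\ x <> idf).
have xP i : rist m G (z i) (x i) /\ x i <> idf.
  apply: (epsilon_spec _ (fun x => rist m G (z i) x /\ x <> idf)).
  by have [y ry yN1] := rist_neq1 (zV i) (zl i); exists y.
have xG i : G (x i) by case: (xP i) => -[].
have [i [j [ltij Kx]]] := pigeonhole sG fK xG.
have xu k : rist m G u (x k).
  by case: (xP k) => + _; apply: rist_mono; apply: in_subtree_cat.
exists (mulf (invf (x i)) (x j)).
  by split=> //; case: (subM (rist_subgroup sG u) (subV (rist_subgroup sG u) (xu i)) (xu j)).
move=> E; have Eij : x i = x j.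
  by apply: functional_extensionality => w; rewrite -[w in LHS](equal_f E) /mulf (invfKV sG).
case: (xP j) => rj; apply; apply: (rist_disjoint sG _ _ rj); last first.
  by rewrite -Eij; case: (xP i) => + _; apply.
by move=> w jw; apply/negP => iw; have := comb_disjoint iw jw => E'; rewrite E' ltnn in ltij.
Qed.

(** Let [x] move [w] below [u], and let [y] be nontrivial in rist_K(w). If they commuted, [y] would
    equal its conjugate by [x] and so lie in rist_K(x w) too, whose support is disjoint. *)
Lemma ristK_nonabelian K u : finite_index m K G -> vertex m u -> 0 < size u ->
  exists x y, [/\ rist m K u x, rist m K u y & mulf x y <> mulf y x].
Proof.
move=> fK vu lu; have [sK [KG _]] := fK.
have [x rx xN1] := ristK_neq1 fK vu lu.
have xA := sub_aut sK (rist_sub rx).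
have [w vw xw] := aut_moves xA xN1.
have uw : in_subtree u w by apply/negPn/negP => nuw; apply: xw; apply: (proj2 rx).
have [|y ry yN1] := ristK_neq1 fK vw; first by apply: leq_trans lu (in_subtree_size uw).
exists x, y; split=> //; first exact: rist_mono ry.
move=> E; have yA := sub_aut sK (rist_sub ry).
apply: yN1; apply: (rist_disjoint (v := x w) sK _ ry).
  move=> v; apply: in_subtree_disjoint; first by rewrite aut_size.
  by apply/eqP => Exw; apply: xw.
suff -> : y = mulf x (mulf y (invf x)) by apply: (rist_conj sK vw) => //; case: rx.
apply: functional_extensionality => v; have := equal_f E (invf x v).
by rewrite /mulf (invfKV sK (rist_sub rx)).
Qed.
End Branch.
End Trees.

(** * Commutators and kernels of retractions *)

Definition commf (x y : perm_fun) : perm_fun := mulf (mulf x y) (invf (mulf y x)).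

Definition retraction (H K : perm_fun -> Prop) (phi : perm_fun -> perm_fun) : Prop :=
  [/\ (forall x y, K x -> K y -> phi (mulf x y) = mulf (phi x) (phi y)),
      (forall x, K x -> H (phi x))
    & (forall h, H h -> phi h = h)].

Section Retracts.
Context (m : nat -> nat).
Implicit Types (G H K : perm_fun -> Prop) (g h x y : perm_fun) (u v w : seq nat).

Lemma commf_in G x y : is_subgroup m G -> G x -> G y -> G (commf x y).
Proof.
move=> sG Gx Gy; have Gyx := subM sG Gy Gx.
exact: (subM sG (subM sG Gx Gy) (subV sG Gyx)).
Qed.

Lemma commf_neq1 G x y : is_subgroup m G -> G x -> G y ->
  mulf x y <> mulf y x -> commf x y <> idf.
Proof.
move=> sG Gx Gy + E; apply; apply: functional_extensionality => w.
by have := equal_f E (mulf y x w); rewrite /commf {1}/mulf (invfK sG (subM sG Gy Gx)).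
Qed.

Section Retraction.
Context (H K : perm_fun -> Prop) (phi : perm_fun -> perm_fun).
Context (sH : is_subgroup m H) (sK : is_subgroup m K) (HK : forall x, H x -> K x).
Context (rphi : retraction H K phi).

Lemma retr1 : phi idf = idf.
Proof. by case: rphi => _ _; apply; exact: sub1 sH. Qed.

Lemma retrV x : K x -> phi (invf x) = invf (phi x).
Proof.
move=> Kx; have [phiM _ _] := rphi; have Kx' := subV sK Kx.
symmetry; apply: invf_eq; rewrite -phiM //.
  by rewrite (mulVf sK Kx) retr1.
by rewrite (mulfV sK Kx) retr1.
Qed.

Lemma retr_iter j x : K x -> phi (iter j x) = iter j (phi x).
Proof.
move=> Kx; have [phiM _ _] := rphi; elim: j => [|j IHj]; first exact: retr1.
by rewrite -[LHS]/(phi (mulf x (iter j x))) (phiM _ _ Kx (sub_iter _ sK Kx)) IHj.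
Qed.

Lemma retr_commf x y : K x -> K y -> phi (mulf x y) = phi (mulf y x) ->
  phi (commf x y) = idf.
Proof.
move=> Kx Ky E; have [phiM phiH _] := rphi; have Kyx := subM sK Ky Kx.
rewrite (phiM _ _ (subM sK Kx Ky) (subV sK Kyx)) E (retrV Kyx).
exact: mulfV sH (phiH _ Kyx).
Qed.

(* An element g of the kernel moving u conjugates rist_K(u) onto a rigid
   stabilizer with disjoint support without changing images under phi, so
   rist_K(u) has abelian image. *)
Lemma ker_moves_commf g u : K g -> phi g = idf -> vertex m u -> g u <> u ->
  forall x y, rist m K u x -> rist m K u y -> phi (commf x y) = idf.
Proof.
move=> Kg g1 vu gu x y rx ry; have [phiM phiH _] := rphi.
have Kx := rist_sub rx; have Ky := rist_sub ry.
apply: retr_commf => //; pose z := mulf g (mulf x (invf g)).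
have Kg' := subV sK Kg; have Kz : K z := subM sK Kg (subM sK Kx Kg').
have phiz : phi z = phi x.
  by rewrite (phiM _ _ Kg (subM sK Kx Kg')) (phiM _ _ Kx Kg') (retrV Kg) g1 invf1.
rewrite (phiM _ _ Kx Ky) (phiM _ _ Ky Kx) -phiz -(phiM _ _ Kz Ky) -(phiM _ _ Ky Kz).
congr phi.
apply: (rist_commute (u := g u) (v := u) sK _ _ ry).
  move=> w; apply: in_subtree_disjoint; last exact/eqP.
  exact: (aut_size _ (sub_aut sK Kg)).
exact: rist_conj.
Qed.

(** Each [k phi(k)^-1] lies in the kernel, so a trivial kernel would force [K = H]; infinite index
    thus yields a nontrivial [g] in the kernel. If [g] moves [w], it moves every vertex below [w],
    which gives the depth [n]. *)
Lemma retraction_commf G n : (forall k, 2 <= m k) -> finite_index m K G ->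
  ~ finite_index m H G ->
  exists u, [/\ vertex m u, n <= size u &
    forall x y, rist m K u x -> rist m K u y -> phi (commf x y) = idf].
Proof.
move=> hm [_ [KG [reps [repG repP]]]] nfi; have [phiM phiH phi1] := rphi.
have [g [Kg g1 gN1]] : exists g, [/\ K g, phi g = idf & g <> idf].
  apply: NNPP => nE; apply: nfi; split=> //; split=> [x /HK/KG//|].
  exists reps; split=> // g /repP[r [k [rr [Kk E]]]]; exists r, k; do 2!split=> //.
  suff -> : k = phi k by apply: phiH.
  have Hk := phiH _ Kk; have Kk' := HK Hk.
  apply: NNPP => kphi; apply: nE; exists (mulf k (invf (phi k))); split.
  - exact: (subM sK Kk (subV sK Kk')).
  - rewrite (phiM _ _ Kk (subV sK Kk')) (retrV Kk') (phi1 _ Hk).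
    exact: mulfV sH Hk.
  move=> E1; apply: kphi; apply: functional_extensionality => w.
  by have := equal_f E1 (phi k w); rewrite /mulf (invfK sK Kk').
have gA := sub_aut sK Kg; have [w vw gw] := aut_moves gA gN1.
exists (w ++ nseq n 0); split.
- by apply: vertex_cat => //; rewrite all_nseq orbT.
- by rewrite size_cat size_nseq leq_addl.
apply: (ker_moves_commf Kg g1).
  by apply: vertex_cat => //; rewrite all_nseq orbT.
move=> /(congr1 (take (size w))); rewrite (aut_take _ gA) ?take_size_cat //.
by apply: vertex_cat => //; rewrite all_nseq orbT.
Qed.
End Retraction.

(** * Components on subtrees; finite generation of rigid stabilizers *)

Definition localize v g : perm_fun :=
  fun w => if vertex m w && in_subtree v w then g w else w.

Lemma localize1 v : localize v idf = idf.
Proof. by apply: functional_extensionality => w; rewrite /localize; case: ifP. Qed.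

(** An element fixing [v] preserves the subtree of [v], so taking components is multiplicative on
    the stabilizer of [v]. A component may lie outside [G], which is why [splits] asks for
    membership. *)
Lemma localizeM v x y : is_aut m y -> y v = v ->
  localize v (mulf x y) = mulf (localize v x) (localize v y).
Proof.
move=> yA yv; apply: functional_extensionality => w; rewrite /localize /mulf.
have [vw /=|nvw] := boolP (vertex m w); last by rewrite /= (negPf nvw).
have [vinw|nv] := boolP (in_subtree v w); last by rewrite vw (negPf nv).
have -> : in_subtree v (y w) by rewrite -yv (aut_subtree _ yA).
by rewrite (aut_vertex _ yA) vw.
Qed.

Section Localize.
Context (G : perm_fun -> Prop) (sG : is_subgroup m G).

Lemma localizeV v x : G x -> x v = v -> localize v (invf x) = invf (localize v x).
Proof.
move=> Gx xv; symmetry; apply: invf_eq; rewrite -localizeM //.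
- by rewrite (mulVf sG Gx) localize1.
- exact: sub_aut sG Gx.
- by rewrite (mulfV sG Gx) localize1.
- exact: sub_aut sG (subV sG Gx).
- by rewrite -{1}xv (invfK sG Gx).
Qed.

Lemma localize_rist v x : rist m G v x -> localize v x = x.
Proof.
case=> Gx x1; apply: functional_extensionality => w; rewrite /localize.
have [_ _ _ _ x0] := sub_aut sG Gx.
have [vw /=|/x0->//] := boolP (vertex m w); by case: ifPn => // /x1->.
Qed.

Lemma localize_out u v x : size u = size v -> u != v -> rist m G u x ->
  localize v x = idf.
Proof.
move=> luv neq [Gx x1]; apply: functional_extensionality => w; rewrite /localize.
case: ifP => // /andP[vw vinw]; apply: x1 => //; apply: in_subtree_disjoint vinw => //.
by rewrite eq_sym.
Qed.

(** [Rist] approached through components instead of generators: these elements form a subgroup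
    containing rist_G(v) for all [v] of level [n], and [localize v] maps it homomorphically into
    rist_G(v). *)
Definition splits n g : Prop :=
  G g /\ forall v, vertex m v -> size v = n -> g v = v /\ G (localize v g).

Lemma splits_subgroup n : is_subgroup m (splits n).
Proof.
apply: (is_subgroup_sub sG) => [x []//||x y [Gx xs] [Gy ys]|x [Gx xs]].
- split=> [|v vv lv]; first exact: (sub1 sG).
  by rewrite localize1; split=> //; exact: (sub1 sG).
- split=> [|v vv lv]; first exact: (subM sG).
  have [xv Gxv] := xs v vv lv; have [yv Gyv] := ys v vv lv.
  rewrite localizeM ?yv //; last exact: sub_aut sG Gy.
  by rewrite /mulf yv xv; split=> //; exact: (subM sG Gxv Gyv).
split=> [|v vv lv]; first exact: (subV sG).
have [xv Gxv] := xs v vv lv; rewrite localizeV //; split; last exact: (subV sG).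
by rewrite -{1}xv (invfK sG Gx).
Qed.

Lemma splits_localize n v g : splits n g -> vertex m v -> size v = n ->
  rist m G v (localize v g).
Proof.
move=> [Gg gs] vv lv; split; first by case: (gs v vv lv).
by move=> w vw nv; rewrite /localize (negPf nv) andbF.
Qed.

Lemma rist_splits v g : vertex m v -> rist m G v g -> splits (size v) g.
Proof.
move=> vv rg; have Gg := rist_sub rg; split=> // w vw lw; split.
  by apply: (rist_fix sG rg) => //; rewrite lw.
have [->|neq] := eqVneq w v; first by rewrite localize_rist.
rewrite (localize_out _ _ rg) //; last by rewrite eq_sym.
exact: (sub1 sG).
Qed.

(** [Rist] has finite index, so it is finitely generated by [schreier]. Since [localize v] retracts
    it onto rist_G(v), the components of its generators generate. *)
Lemma rist_fin_gen v : fin_gen m G -> is_branch m G -> vertex m v -> 0 < size v ->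
  fin_gen m (rist m G v).
Proof.
move=> fgG [_ fi] vv lv; have fiR := fi _ lv; have [sR _] := fiR.
have [s [sP sgen]] := fin_gen_gens sR (schreier sG fgG fiR).
have Rsplits x : Rist m G (size v) x -> splits (size v) x.
  by apply: gen_sub; [exact: splits_subgroup|move=> y [w [vw <- ry]]; exact: rist_splits].
have sr := rist_subgroup sG v.
have tP x : List.In x (List.map (localize v) s) -> rist m G v x.
  by case/List.in_map_iff => y [<- /sP/Rsplits]; move/splits_localize; apply.
apply: (gens_fin_gen sr tP) => g rg; rewrite -(localize_rist rg).
have st := gen_subgroup sr tP.
have /sgen sg : Rist m G (size v) g by apply: gen_in; exists v.
apply: (gen_ind (P := fun g => gen m _ (localize v g)) (splits_subgroup (size v))
  _ _ _ _ _ sg).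
- by move=> x /sP/Rsplits.
- by rewrite localize1; exact: sub1 st.
- by move=> x sx; apply: gen_in; apply/List.in_map_iff; exists x.
- move=> x y [Gx xs] [Gy ys] xt yt; have [yv _] := ys v vv erefl.
  by rewrite localizeM //; [exact: (subM st)|exact: sub_aut sG Gy].
move=> x [Gx xs] xt; have [xv _] := xs v vv erefl.
by rewrite localizeV //; exact: (subV st).
Qed.
End Localize.

Lemma finite_level n : exists l, forall v, vertex m v -> size v = n -> List.In v l.
Proof.
elim: n => [|n [l lP]].
  by exists [:: [::]] => v _ /size0nil->; left.
exists (List.map (fun p => rcons p.1 p.2) (List.list_prod l (List.seq 0 (m n)))).
move=> v; case/lastP: v => [//|v a] vv; rewrite size_rcons => -[lv].
apply/List.in_map_iff; exists (v, a); split=> //; apply/List.in_prod_iff; split.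
  by apply: lP => //; rewrite -[v](take_size_cat [:: a] erefl) cats1 vertex_take.
apply/List.in_seq; split; first exact/leP.
have /vertexP/(_ n) := vv; rewrite size_rcons lv ltnSn nth_rcons lv ltnn eqxx.
by move=> /(_ isT)/ltP.
Qed.

(** The lists for the finitely many vertices of the level are concatenated. Quantifying over [H]
    after the list allows [H] to be defined from that list. *)
Lemma level_gens n (Q : perm_fun -> Prop) (W : seq nat -> (perm_fun -> Prop) -> Prop) :
  (forall v, vertex m v -> size v = n -> exists t, (forall x, List.In x t -> Q x) /\
     forall H, is_subgroup m H -> (forall x, List.In x t -> H x) -> W v H) ->
  exists t, (forall x, List.In x t -> Q x) /\
     forall H, is_subgroup m H -> (forall x, List.In x t -> H x) ->
     forall v, vertex m v -> size v = n -> W v H.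
Proof.
move=> hW; have [l lP] := finite_level n.
have [l' l'P] := list_filter (fun v => vertex m v /\ size v = n) l.
have hW' v : List.In v l' -> exists t, (forall x, List.In x t -> Q x) /\
     forall H, is_subgroup m H -> (forall x, List.In x t -> H x) -> W v H.
  by case/l'P => _ [vv lv]; apply: hW.
have [L [LP LQ]] := list_choice hW'.
exists (List.concat L); split=> [x /List.in_concat[t [/LQ[v [_ [tQ _]]] /tQ]]//|].
move=> H sH HL v vv lv; have [|t [tL [_ tW]]] := LP v; first by apply/l'P; auto.
by apply: tW => // x tx; apply: HL; apply/List.in_concat; exists t.
Qed.
End Retracts.

Lemma iter_idf j : iter j idf = idf.
Proof. by apply: functional_extensionality => w; elim: j => //= j ->. Qed.

(** * Groups with torsion *)

Section Torsion.
Context (m : nat -> nat) (hm : forall n, 2 <= m n) (G : perm_fun -> Prop).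
Context (sG : is_subgroup m G) (hfg : fin_gen m G) (hbr : is_branch m G).
Implicit Types (g h x y c d : perm_fun) (u v w : seq nat).

(** With [p] the least prime factor of [q] and [r = q / p], either [g^r] has order [p], or [g^r = 1]
    and induction applies to [r]. *)
Lemma prime_order g q : G g -> g <> idf -> 0 < q -> iter q g = idf ->
  exists s p, [/\ G s, prime p, s <> idf & iter p s = idf].
Proof.
elim/ltn_ind: q g => q IHq g Gg gN1 q0 gq; have [q1|q1] := leqP q 1.
  by case: gN1; rewrite -gq; have -> : q = 1 by apply/eqP; rewrite eqn_leq q1.
have pp := pdiv_prime q1; pose r := q %/ pdiv q.
have Eq : q = pdiv q * r by rewrite mulnC divnK ?pdiv_dvd.
have r0 : 0 < r by move: q0; rewrite Eq muln_gt0 => /andP[].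
have [gr|gr] := classic (iter r g = idf).
  by apply: (IHq r) gr => //; rewrite Eq -[X in X < _]mul1n ltn_pmul2r // prime_gt1.
exists (iter r g), (pdiv q); split=> //; first exact: (sub_iter _ sG Gg).
by apply: functional_extensionality => w; rewrite -iterM -Eq gq.
Qed.

Section PrimeOrder.
Context (s : perm_fun) (p : nat) (Gs : G s) (pp : prime p) (sp : iter p s = idf).

Let sA : is_aut m s. Proof. exact: sub_aut sG Gs. Qed.

Let iterA j : is_aut m (iter j s).
Proof. by apply: (sub_aut sG); exact: (sub_iter _ sG Gs). Qed.

Lemma iter_mulp k w : iter (k * p) s w = w.
Proof. by rewrite iterM sp iter_idf. Qed.

Lemma iter_modp k w : iter (k %% p) s w = iter k s w.
Proof. by rewrite {2}(divn_eq k p) addnC iterD iter_mulp. Qed.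

(** Bezout gives [a p = 1 + b j], so a vertex fixed by [s^j] is fixed by [s]. *)
Lemma iter_moves v j : s v <> v -> 0 < j < p -> iter j s v <> v.
Proof.
move=> sv /andP[j0 jp] E.
have cop : coprime p j by rewrite prime_coprime // gtnNdvd.
have [[a b] /= Eab] := coprimeP j (prime_gt0 pp) cop.
have E1 : a * p = 1 + b * j.
  by apply/eqP; rewrite -Eab subnK // ltnW // -subn_gt0 Eab.
apply: sv; have := iter_mulp a v; rewrite E1 iterD iterM.
suff -> : iter b (iter j s) v = v by [].
by elim: b {Eab E1} => //= b ->.
Qed.

(* For c supported on T_v with s v <> v, (s c)^p is the product of the
   conjugates of c by the powers of s, because s^p = 1. *)
Definition orbit_prod c : perm_fun := iter p (mulf s c).

Lemma orbit_prod_in c : G c -> G (orbit_prod c).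
Proof. by move=> Gc; exact: (sub_iter _ sG (subM sG Gs Gc)). Qed.

Section Orbit.
Context (v : seq nat) (sv : s v <> v).

(** The factor [c] acts only in the first step: afterwards the point runs through the subtrees of
    [s^i v] with [0 < i < p], disjoint from that of [v]. *)
Lemma orbit_prod_from c w i : rist m G v c -> vertex m w -> in_subtree v w ->
  0 < i <= p -> iter i (mulf s c) w = iter i s (c w).
Proof.
move=> rc vw vinw; have cA := sub_aut sG (rist_sub rc).
case: i => // i; elim: i => // i IHi /andP[_ ip].
rewrite iterS IHi /= ?(ltnW ip) // -iterS [in LHS]/mulf (proj2 rc) //.
  by rewrite (aut_vertex _ (iterA _)) (aut_vertex _ cA).
apply: (in_subtree_disjoint (u := iter i.+1 s v)).
- exact: aut_size (iterA _).
- by apply/eqP; exact: iter_moves.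
- by rewrite (aut_subtree _ (iterA _)) ?(aut_vertex _ cA) // (rist_subtree sG rc).
Qed.

(** A point below [s^k v] re-enters the subtree of [v] only after [p - k] steps; until then each
    step acts as [s]. *)
Lemma orbit_prod_return c w k : rist m G v c -> vertex m w -> in_subtree v w ->
  0 < k <= p -> iter (p - k) (mulf s c) (iter k s w) = w.
Proof.
move=> rc vw vinw /andP[k0 kp].
have E i : i <= p - k -> iter i (mulf s c) (iter k s w) = iter (i + k) s w.
  elim: i => // i IHi ik; rewrite iterS IHi ?(ltnW ik) // [in LHS]/mulf (proj2 rc) //.
    by rewrite (aut_vertex _ (iterA _)).
  apply: (in_subtree_disjoint (u := iter (i + k) s v)).
  - exact: aut_size (iterA _).
  - by apply/eqP; apply: iter_moves; rewrite // addn_gt0 k0 orbT /= addnC -ltn_subRL.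
  - by rewrite (aut_subtree _ (iterA _)).
by rewrite E // subnK // sp.
Qed.

(** The first [p - k] steps bring the point back to [w]; the other [k] apply [c] once and end at
    [s^k (c w)]. For [k = 0] all [p] steps start below [v], and [s^p = 1] closes the cycle. *)
Lemma orbit_prodE c w k : rist m G v c -> vertex m w -> in_subtree v w -> k < p ->
  orbit_prod c (iter k s w) = iter k s (c w).
Proof.
move=> rc vw vinw kp; rewrite /orbit_prod; case: k kp => [|k] kp.
  rewrite (orbit_prod_from rc) ?leqnn ?prime_gt0 //=.
  by rewrite -[RHS](iter_mulp 1) mul1n.
rewrite -(subnKC (ltnW kp)) iterD (orbit_prod_return rc) ?(ltnW kp) //.
by rewrite (orbit_prod_from rc) ?(ltnW kp).
Qed.

Lemma orbit_prod_fix c w : rist m G v c -> vertex m w ->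
  (forall j, ~~ in_subtree v (iter j s w)) -> orbit_prod c w = w.
Proof.
move=> rc vw nw; rewrite -[RHS](iter_mulp 1) mul1n /orbit_prod.
elim: {1 2}p => // i IHi; rewrite !iterS IHi /mulf (proj2 rc) //.
by rewrite (aut_vertex _ (iterA _)).
Qed.

Lemma orbit_cases w : vertex m w ->
  (exists k w0, [/\ k < p, vertex m w0, in_subtree v w0 & w = iter k s w0]) \/
  (forall j, ~~ in_subtree v (iter j s w)).
Proof.
move=> vw; have [[j jw]|nj] := classic (exists j, in_subtree v (iter j s w)); last first.
  by right=> j; apply/negP => jw; apply: nj; exists j.
(* The exponent [j (p - 1)] is [-j] modulo [p]. *)
left; exists ((j * p.-1) %% p), (iter j s w); split=> //.
- by rewrite ltn_pmod ?prime_gt0.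
- by rewrite (aut_vertex _ (iterA _)).
by rewrite iter_modp -iterD addnC -mulnS prednK ?prime_gt0 // iter_mulp.
Qed.

Lemma orbit_prodM c d : rist m G v c -> rist m G v d ->
  orbit_prod (mulf c d) = mulf (orbit_prod c) (orbit_prod d).
Proof.
move=> rc rd; have rcd := subM (rist_subgroup sG v) rc rd.
have dA := sub_aut sG (rist_sub rd).
have oG x : rist m G v x -> G (orbit_prod x) by move=> /rist_sub; exact: orbit_prod_in.
apply: aut_ext (sub_aut sG (oG _ rcd)) (sub_aut sG (subM sG (oG _ rc) (oG _ rd))) _.
move=> w vw; rewrite [RHS]/mulf.
have [[k [w0 [kp vw0 vinw ->]]]|nw] := orbit_cases vw.
  rewrite !orbit_prodE ?(aut_vertex _ dA) //.
  by rewrite (rist_subtree sG rd).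
by rewrite !orbit_prod_fix.
Qed.

Lemma orbit_prod_commute c w : rist m G v c -> vertex m w ->
  orbit_prod c (s w) = s (orbit_prod c w).
Proof.
move=> rc vw; have [[k [w0 [kp vw0 vinw ->]]]|nw] := orbit_cases vw; last first.
  rewrite !orbit_prod_fix // ?(aut_vertex _ sA) // => j.
  by rewrite -iterSr.
rewrite -iterS [in RHS]orbit_prodE // -iterS.
(* If [k + 1 = p], the orbit closes up and [s^p w0] is read as [s^0 w0]. *)
move: kp; rewrite leq_eqVlt => /orP[/eqP->|kp]; last by rewrite orbit_prodE.
by rewrite sp -[in LHS](_ : iter 0 s w0 = w0) // orbit_prodE ?prime_gt0.
Qed.

Lemma orbit_prod_eq1 c : rist m G v c -> orbit_prod c = idf -> c = idf.
Proof.
move=> rc E; have cA := sub_aut sG (rist_sub rc).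
apply: aut_ext cA (sub_aut sG (sub1 sG)) _ => w vw.
have [vinw|/(proj2 rc _ vw)//] := boolP (in_subtree v w).
by rewrite -[c w](orbit_prodE (k := 0) rc) ?prime_gt0 //= E.
Qed.
End Orbit.

Definition moved n w : Prop := s (take n w) <> take n w.

(** The invariant shared by all generators of [H]. Its first clause makes the commutation clause
    stable under products and inverses. *)
Definition centralizes_moved n h : Prop := forall w, vertex m w ->
  (moved n (h w) <-> moved n w) /\ (moved n w -> h (s w) = s (h w)).

Lemma centralizes_moved_subgroup n :
  is_subgroup m (fun h => G h /\ centralizes_moved n h).
Proof.
apply: (is_subgroup_sub sG) => [x []//||x y [Gx xc] [Gy yc]|x [Gx xc]].
- by split=> //; exact: sub1 sG.
- split; first exact: (subM sG).
  move=> w vw; rewrite /mulf; have [yw ys] := yc w vw.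
  have [|xw xs] := xc (y w); first by rewrite (aut_vertex _ (sub_aut sG Gy)).
  by split=> [|mw]; [rewrite xw|rewrite ys // xs //; apply/yw].
split; first exact: (subV sG).
move=> w vw; have xA := sub_aut sG Gx.
have [|] := xc (invf x w).
  by rewrite (aut_vertex _ (sub_aut sG (subV sG Gx))).
rewrite (invfKV sG Gx) => xw xs; split=> [|mw]; first by rewrite xw.
by apply: (aut_inj xA); rewrite (invfKV sG Gx) xs ?(invfKV sG Gx) //; apply/xw.
Qed.

Lemma commute_centralizes_moved n h : G h ->
  (forall w, vertex m w -> h (s w) = s (h w)) -> centralizes_moved n h.
Proof.
move=> Gh hs w vw; split=> [|_]; last exact: hs.
have hA := sub_aut sG Gh; rewrite /moved (aut_take _ hA) // -hs ?vertex_take //.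
by split=> sw E; apply: sw; [rewrite E|apply: (aut_inj hA)].
Qed.

Lemma prime_order_not_LR : s <> idf -> ~ has_LR m G.
Proof.
move=> sN1 LR; have [v vv sv] := aut_moves sA sN1; set n := size v.
have n0 : 0 < n.
  rewrite lt0n; apply/eqP => /size0nil Ev; apply: sv.
  by rewrite Ev; apply: size0nil; rewrite (aut_size _ sA).
(* What [c] in rist_G(u) contributes to [H]: itself over a vertex fixed by [s], its orbit product
   over a moved one. *)
pose F u c := if s u == u then c else orbit_prod c.
have [t [tP tF]] : exists t,
    (forall x, List.In x t -> G x /\ centralizes_moved n x) /\
    forall H, is_subgroup m H -> (forall x, List.In x t -> H x) ->
    forall u, vertex m u -> size u = n -> forall c, rist m G u c -> H (F u c).
  apply: (level_gens (W := fun u H => forall c, rist m G u c -> H (F u c))).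
  move=> u vu lu; have ru := rist_subgroup sG u.
  have [|t [tr tgen]] := fin_gen_gens ru (rist_fin_gen sG hfg hbr vu _); first by rewrite lu.
  exists (List.map (F u) t); split.
    move=> x /List.in_map_iff[c [<- /tr rc]]; have Gc := rist_sub rc.
    rewrite /F; case: eqP => su.
      split=> // w vw; have [uw|nuw] := boolP (in_subtree u w).
        have muw (y : seq nat) : in_subtree u y -> ~ moved n y.
          by move=> /eqP; rewrite lu /moved => ->.
        have /muw ncw : in_subtree u (c w) by rewrite (rist_subtree sG rc).
        by split; [split=> [/ncw|/(muw _ uw)]|move=> /(muw _ uw)].
      rewrite (proj2 rc w vw nuw) (proj2 rc) ?(aut_vertex _ sA) //.
      by rewrite -su (aut_subtree _ sA).
    split; first exact: orbit_prod_in.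
    apply: commute_centralizes_moved; first exact: orbit_prod_in.
    by move=> w vw; exact: orbit_prod_commute rc vw.
  move=> H sH tH c rc; have := tgen _ rc.
  have inH x : List.In x t -> H (F u x).
    by move=> tx; apply: tH; apply/List.in_map_iff; exists x.
  rewrite /F in inH *; case: eqP inH => su inH; first by apply: gen_sub.
  (* Over a moved vertex [orbit_prod] is a homomorphism on rist_G(u), so it is enough to have its
     values on generators. *)
  have H1 : orbit_prod idf = idf by rewrite -[RHS]sp.
  have FM x y : rist m G u x -> rist m G u y ->
      orbit_prod (mulf x y) = mulf (orbit_prod x) (orbit_prod y).
    exact: orbit_prodM.
  apply: (gen_ind (P := fun c => H (orbit_prod c)) ru tr) => //.
  - by rewrite H1; exact: sub1 sH.
  - by move=> x y rx ry Hx Hy; rewrite FM //; exact: (subM sH).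
  move=> x rx Hx; have rx' := subV ru rx; suff <- : invf (orbit_prod x) = orbit_prod (invf x).
    exact: (subV sH).
  by apply: invf_eq; rewrite -FM // ?(mulVf ru rx) ?(mulfV ru rx) H1.
pose S x := List.In x (s :: t).
have SP x : S x -> G x /\ centralizes_moved n x.
  case=> [<-|/tP//]; split=> //; exact: commute_centralizes_moved.
have SG x : S x -> G x by move=> /SP[].
have sH := gen_subgroup sG SG; set H := gen m S in sH.
have HP x : H x -> G x /\ centralizes_moved n x.
  exact: (gen_sub (A := fun x => G x /\ _ x) (centralizes_moved_subgroup n) SP).
have SH x : S x -> H x by exact: gen_in.
have Hs : H s by apply: SH; left.
have HF u : vertex m u -> size u = n -> forall c, rist m G u c -> H (F u c).
  by apply: (tF _ sH) => x tx; apply: SH; right.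
have [||K [fK [HK [phi rphi]]]] := LR H sH.
- by move=> x Hx; case: (HP x Hx).
- exact: fin_gen_list sG SG.
(* Finite index would give a nontrivial [h] in rist_H(v). It fixes the subtree of [s v] pointwise,
   and commuting with [s] on the subtree of [v] makes it trivial there too. *)
have nfi : ~ finite_index m H G.
  move=> fH; have [h [Hh h1]] := ristK_neq1 hm sG hbr fH vv n0; apply.
  have [Gh hc] := HP h Hh; apply: aut_ext (sub_aut sG Gh) (sub_aut sG (sub1 sG)) _.
  move=> w vw; have [vinw|/(h1 _ vw)//] := boolP (in_subtree v w).
  have [_] := hc w vw; rewrite h1 ?(aut_vertex _ sA) //.
    move=> E; apply: (aut_inj sA); rewrite -E //.
    by rewrite /moved (eqP vinw).
  apply: (in_subtree_disjoint (u := s v)); rewrite ?(aut_size _ sA) ?(aut_subtree _ sA) //.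
  exact/eqP.
have sK : is_subgroup m K by case: fK.
have KG : forall x, K x -> G x by case: fK => _ [].
have [u [vu nu phi1]] := retraction_commf sH sK HK rphi n hm fK nfi.
have [|x [y [rx ry xy]]] := ristK_nonabelian hm sG hbr fK vu; first exact: leq_trans nu.
have Kx := rist_sub rx; have Ky := rist_sub ry.
have cN1 := commf_neq1 sK Kx Ky xy; have c1 := phi1 _ _ rx ry.
have [Kc cu] := commf_in (rist_subgroup sK u) rx ry; set c := commf x y in cN1 c1 Kc cu.
have rc : rist m G (take n u) c.
  apply: (rist_mono (u := u)); last by split=> //; exact: KG.
  by rewrite /in_subtree size_takel.
(* [phi] fixes the element that [c] contributes to [H]. Over a fixed vertex this reads
   [c = phi c = 1]; over a moved one the orbit product equals [(phi s phi c)^p = s^p = 1]. *)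
have := HF _ (vertex_take n vu) (size_takel nu) c rc; have [phiM _ phiH] := rphi.
rewrite /F; case: eqP => su Hc; apply: cN1; first by rewrite -(phiH _ Hc).
apply: (orbit_prod_eq1 su rc).
rewrite -(phiH _ Hc) /orbit_prod (retr_iter sH sK rphi _ (subM sK (HK _ Hs) Kc)).
by rewrite (phiM _ _ (HK _ Hs) Kc) c1 (phiH _ Hs).
Qed.
End PrimeOrder.

Lemma torsion_not_LR g q : G g -> g <> idf -> 0 < q -> iter q g = idf -> ~ has_LR m G.
Proof.
move=> Gg gN1 q0 gq; have [s [p [Gs pp sN1 sp]]] := prime_order Gg gN1 q0 gq.
exact: prime_order_not_LR Gs pp sp sN1.
Qed.
End Torsion.

(** * Rigid stabilizers with an element of infinite order *)

Section InfiniteOrder.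
Context (m : nat -> nat).
Implicit Types (A C G H K R : perm_fun -> Prop) (g h x y c d : perm_fun).
Implicit Types (u v w : seq nat).

Lemma centralizer_subgroup A x : is_subgroup m A ->
  is_subgroup m (fun y => A y /\ mulf x y = mulf y x).
Proof.
move=> sA; apply: (is_subgroup_sub sA) => [y []//||y z [Ay xy] [Az xz]|y [Ay xy]].
- by split=> //; exact: sub1 sA.
- split; first exact: subM sA Ay Az.
  by rewrite -[LHS]/(mulf (mulf x y) z) xy -[LHS]/(mulf y (mulf x z)) xz.
split; first exact: subV sA Ay.
apply: functional_extensionality => w; have := equal_f xy (invf y w).
by rewrite /mulf (invfKV sA Ay) => ->; rewrite (invfK sA Ay).
Qed.

(** Centralizers are subgroups: that of [g] contains [x], so that of [x] contains [g] and hence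
    [y]. *)
Lemma cyclic_commute A g x y : is_subgroup m A -> A g ->
  gen m (fun z => List.In z [:: g]) x -> gen m (fun z => List.In z [:: g]) y ->
  mulf x y = mulf y x.
Proof.
move=> sA Ag Cx Cy.
have comm z t : (A t /\ mulf z t = mulf t z) ->
    forall r, gen m (fun z => List.In z [:: t]) r -> mulf z r = mulf r z.
  move=> zt r Cr; suff [] : A r /\ mulf z r = mulf r z by [].
  by apply: (gen_sub (A := fun r => A r /\ _) (centralizer_subgroup z sA)) Cr => _ [<-|[]].
apply: (comm x g) Cy; split=> //; symmetry; exact: (comm g g) Cx.
Qed.

Lemma hom1 C G theta : is_subgroup m C -> is_subgroup m G ->
  (forall x y, C x -> C y -> theta (mulf x y) = mulf (theta x) (theta y)) ->
  (forall x, C x -> G (theta x)) -> theta idf = idf.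
Proof.
move=> sC sG thM thG; have C1 := sub1 sC; have Gt := thG _ C1.
by apply: (mulfI sG Gt); exact: esym (thM _ _ C1 C1).
Qed.

Lemma homV C G theta x : is_subgroup m C -> is_subgroup m G ->
  (forall x y, C x -> C y -> theta (mulf x y) = mulf (theta x) (theta y)) ->
  (forall x, C x -> G (theta x)) -> C x -> theta (invf x) = invf (theta x).
Proof.
move=> sC sG thM thG Cx; have Cx' := subV sC Cx; have th1 := hom1 sC sG thM thG.
symmetry; apply: invf_eq.
  by rewrite -(thM _ _ Cx' Cx) (mulVf sC Cx) th1.
by rewrite -(thM _ _ Cx Cx') (mulfV sC Cx) th1.
Qed.

(* The products a * theta (phi a) stand for the elements of a fibre product
   over the cyclic group <g>, of which the hypotheses provide generators. *)
Lemma fiber_kernel G A K R H t g phi theta (C := gen m (fun z => List.In z [:: g])) :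
  is_subgroup m G -> is_subgroup m A -> is_subgroup m K -> is_subgroup m R ->
  is_subgroup m H -> (forall x, A x -> G x) ->
  A g -> (forall x, R x -> A x) -> (forall x, R x -> K x) ->
  retraction C K phi ->
  (forall x y, C x -> C y -> theta (mulf x y) = mulf (theta x) (theta y)) ->
  (forall x, C x -> G (theta x)) ->
  (forall x y, A x -> C y -> mulf x (theta y) = mulf (theta y) x) ->
  (forall x, List.In x t -> R x) ->
  (forall x, R x -> gen m (fun z => List.In z t) x) ->
  (forall x, List.In x t -> H (mulf x (invf (phi x)))) -> H (mulf g (theta g)) ->
  forall x, R x -> phi x = idf -> H x.
Proof.
move=> sG sA sK sR sH AG Ag RA RK rphi thM thG cm tR tgen tH gH.
have gA x : List.In x [:: g] -> A x by case=> [<-|[]].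
have sC : is_subgroup m C := gen_subgroup sA gA.
have CA x : C x -> A x := gen_sub sA gA.
have th1 := hom1 sC sG thM thG.
have [phiM phiC _] := rphi; have phi1 := retr1 sC rphi.
pose prod x z := mulf x (theta z).
have prodM x y z r : A x -> A y -> C z -> C r ->
    mulf (prod x z) (prod y r) = prod (mulf x y) (mulf z r).
  move=> Ax Ay Cz Cr; rewrite /prod thM //; apply: functional_extensionality => w.
  by have := equal_f (cm _ _ Ay Cz) (theta r w); rewrite /mulf => ->.
have prodV x z : A x -> C z -> invf (prod x z) = prod (invf x) (invf z).
  move=> Ax Cz; have Ax' := subV sA Ax; have Cz' := subV sC Cz.
  rewrite {1}/prod cm // (invfM sG (thG _ Cz) (AG _ Ax)).
  by rewrite -(homV sC sG thM thG Cz).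
have Cprod x : C x -> H (prod x x).
  apply: (gen_ind (P := fun x => H (prod x x)) sC).
  - by move=> y gy; apply: gen_in.
  - by rewrite /prod th1; exact: sub1 sH.
  - by move=> _ [<-|[]].
  - by move=> y z Cy Cz Hy Hz; rewrite -prodM; auto; exact: (subM sH).
  - by move=> y Cy Hy; rewrite -prodV; auto; exact: (subV sH).
(* [x theta(phi x)] is multiplicative in [x], so generators [y] of [R] suffice; there it is the
   product of [y phi(y)^-1] and [phi(y) theta(phi y)], both in [H]. *)
suff RP x : R x -> H (prod x (phi x)).
  by move=> x /RP + E; rewrite E /prod th1.
move=> Rx; apply: (gen_ind (P := fun x => H (prod x (phi x))) sR tR) (tgen _ Rx).
- by rewrite phi1 /prod th1; exact: sub1 sH.
- move=> y ty; have Ry := tR _ ty; have Cy := phiC _ (RK _ Ry).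
  have := subM sH (tH _ ty) (Cprod _ Cy); congr H.
  apply: functional_extensionality => w; rewrite /prod /mulf.
  by rewrite (invfK sC Cy).
- move=> y z Ry Rz Hy Hz; rewrite (phiM _ _ (RK _ Ry) (RK _ Rz)) -prodM; auto.
  exact: (subM sH).
- move=> y Ry Hy; rewrite (retrV sC sK rphi (RK _ Ry)) -prodV; auto.
  exact: (subV sH).
Qed.

Section Branch.
Context (hm : forall n, 2 <= m n) (G : perm_fun -> Prop).
Context (sG : is_subgroup m G) (hfg : fin_gen m G) (hbr : is_branch m G).

Section Fiber.
Context (v1 v2 : seq nat) (g1 g2 s s' : perm_fun) (K1 K2 : perm_fun -> Prop).
Context (phi1 phi2 : perm_fun -> perm_fun).
Let C1 := gen m (fun z => List.In z [:: g1]).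
Let C2 := gen m (fun z => List.In z [:: g2]).
Context (vv1 : vertex m v1) (vv2 : vertex m v2) (lv : size v1 = size v2) (neq : v1 != v2).
Context (rg1 : rist m G v1 g1) (rg2 : rist m G v2 g2).
Context (sK1 : is_subgroup m K1) (sK2 : is_subgroup m K2).
Context (CK1 : forall x, C1 x -> K1 x) (CK2 : forall x, C2 x -> K2 x).
Context (rphi1 : retraction C1 K1 phi1) (rphi2 : retraction C2 K2 phi2).
Context (ss' : cancel s s') (s's : cancel s' s).
Context (Eg2 : g2 = mulf s (mulf g1 s')).

Let theta x := mulf s (mulf x s').

Let thetaM x y : theta (mulf x y) = mulf (theta x) (theta y).
Proof. by apply: functional_extensionality => w; rewrite /theta /mulf ss'. Qed.

Let theta1 : theta idf = idf.
Proof. by apply: functional_extensionality => w; rewrite /theta /mulf /idf s's. Qed.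

Let theta_inj x y : theta x = theta y -> x = y.
Proof.
move=> E; apply: functional_extensionality => w; apply: (can_inj ss').
by have := equal_f E (s w); rewrite /theta /mulf ss'.
Qed.

Let sC1 : is_subgroup m C1.
Proof. by apply: (gen_subgroup (rist_subgroup sG v1)) => _ [<-|[]]. Qed.

Let sC2 : is_subgroup m C2.
Proof. by apply: (gen_subgroup (rist_subgroup sG v2)) => _ [<-|[]]. Qed.

(** The fibre product given by conditions on components; [theta], conjugation by [s], identifies the
    cyclic groups of [g1] and [g2]. It bounds from above the group [H] given by generators. *)
Definition in_fiber h : Prop :=
  [/\ splits m G (size v1) h, K1 (localize m v1 h), K2 (localize m v2 h)
    & theta (phi1 (localize m v1 h)) = phi2 (localize m v2 h)].

Lemma in_fiber_subgroup : is_subgroup m in_fiber.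
Proof.
have [phi1M _ _] := rphi1; have [phi2M _ _] := rphi2.
apply: (is_subgroup_sub sG) => [x [[]]//||x y|x].
- split; rewrite ?localize1; first exact: (sub1 (splits_subgroup sG _)).
  + exact: sub1 sK1.
  + exact: sub1 sK2.
  + by rewrite (retr1 sC1 rphi1) (retr1 sC2 rphi2).
- move=> [xs x1 x2 Ex] [ys y1 y2 Ey].
  have [Gy yf] := ys; have yA := sub_aut sG Gy.
  have [yv1 _] := yf _ vv1 erefl; have [yv2 _] := yf _ vv2 (esym lv).
  split; rewrite ?(localizeM _ yA yv1) ?(localizeM _ yA yv2).
  + exact: (subM (splits_subgroup sG _) xs ys).
  + exact: subM sK1 x1 y1.
  + exact: subM sK2 x2 y2.
  + by rewrite (phi1M _ _ x1 y1) (phi2M _ _ x2 y2) thetaM Ex Ey.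
move=> [xs x1 x2 Ex]; have [Gx xf] := xs.
have [xv1 _] := xf _ vv1 erefl; have [xv2 _] := xf _ vv2 (esym lv).
split; rewrite ?(localizeV sG Gx xv1) ?(localizeV sG Gx xv2).
+ exact: (subV (splits_subgroup sG _) xs).
+ exact: subV sK1 x1.
+ exact: subV sK2 x2.
rewrite (retrV sC1 sK1 rphi1 x1) (retrV sC2 sK2 rphi2 x2) -Ex.
have [_ phi1C _] := rphi1; have Cx := phi1C _ x1.
symmetry; apply: invf_eq; rewrite -thetaM ?(mulVf sC1 Cx) //.
by rewrite (mulfV sC1 Cx).
Qed.

Lemma in_fiber1 x : rist m G v1 x -> K1 x -> phi1 x = idf -> in_fiber x.
Proof.
move=> rx Kx E; rewrite /in_fiber (localize_rist sG rx) (localize_out lv neq rx) E theta1.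
by split=> //; [exact: rist_splits|exact: sub1 sK2|rewrite (retr1 sC2 rphi2)].
Qed.

Lemma in_fiber2 x : rist m G v2 x -> K2 x -> phi2 x = idf -> in_fiber x.
Proof.
move=> rx Kx E; have neq' : v2 != v1 by rewrite eq_sym.
rewrite /in_fiber (localize_rist sG rx) (localize_out (esym lv) neq' rx) E.
rewrite (retr1 sC1 rphi1) theta1; split=> //; last exact: sub1 sK1.
by rewrite lv; exact: rist_splits.
Qed.

Lemma in_fiber_out u x : vertex m u -> size u = size v1 -> u != v1 -> u != v2 ->
  rist m G u x -> in_fiber x.
Proof.
move=> vu lu u1 u2 rx; have lu2 : size u = size v2 by rewrite lu.
rewrite /in_fiber (localize_out lu u1 rx) (localize_out lu2 u2 rx).
rewrite (retr1 sC1 rphi1) theta1 (retr1 sC2 rphi2).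
by split; [rewrite -lu; exact: rist_splits|exact: sub1 sK1|exact: sub1 sK2|].
Qed.

Lemma in_fiber_gen : in_fiber (mulf g1 g2).
Proof.
have [Gg1 _] := rg1; have [Gg2 _] := rg2; have g2A := sub_aut sG Gg2.
have neq' : v2 != v1 by rewrite eq_sym.
have g2v u : vertex m u -> size u = size v1 -> g2 u = u.
  by move=> vu lu; apply: (rist_fix sG rg2); rewrite // lu lv.
have L1 : localize m v1 (mulf g1 g2) = g1.
  rewrite (localizeM _ g2A (g2v _ vv1 erefl)) (localize_rist sG rg1).
  by rewrite (localize_out (esym lv) neq' rg2).
have L2 : localize m v2 (mulf g1 g2) = g2.
  rewrite (localizeM _ g2A (g2v _ vv2 (esym lv))) (localize_rist sG rg2).
  by rewrite (localize_out lv neq rg1).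
have [_ _ phi1C] := rphi1; have [_ _ phi2C] := rphi2.
have Cg1 : C1 g1 by apply: gen_in; left.
have Cg2 : C2 g2 by apply: gen_in; left.
split; rewrite ?L1 ?L2; [|exact: CK1|exact: CK2|by rewrite phi1C // phi2C].
apply: (subM (splits_subgroup sG _)); first exact: rist_splits.
by rewrite lv; exact: rist_splits.
Qed.

(** The component of [g1^j] at [v2] is 1, so the fibre condition forces [theta (g1^j) = 1]. *)
Lemma in_fiber_power j : in_fiber (iter j g1) -> iter j g1 = idf.
Proof.
have rj : rist m G v1 (iter j g1) := sub_iter j (rist_subgroup sG v1) rg1.
case=> _ _ _; rewrite (localize_rist sG rj) (localize_out lv neq rj).
have [_ _ phi1C] := rphi1; rewrite phi1C; last first.
  by apply: (sub_iter _ sC1); apply: gen_in; left.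
by move=> E; apply: theta_inj; rewrite E (retr1 sC2 rphi2) theta1.
Qed.
End Fiber.

Lemma infinite_order_not_LR v1 g1 : vertex m v1 -> 0 < size v1 -> rist m G v1 g1 ->
  (forall j, 0 < j -> iter j g1 <> idf) -> ~ has_LR m G.
Proof.
move=> vv1 lv1 rg1 g1N1 LR; set n := size v1.
(* Since [n > 0], one of [0^n] and [1^n] differs from [v1]. *)
have [v2 [vv2 lv neq]] : exists v2, [/\ vertex m v2, size v1 = size v2 & v1 != v2].
  have vnseq a : a < 2 -> vertex m (nseq n a).
    by move=> a2; apply: (@vertex_cat _ [::]) => //; rewrite all_nseq a2 orbT.
  have [E|neq] := eqVneq v1 (nseq n 0); last by exists (nseq n 0); rewrite size_nseq vnseq.
  exists (nseq n 1); rewrite size_nseq vnseq //; split=> //; rewrite E.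
  by rewrite /n; case: (size v1) lv1.
have neq' : v2 != v1 by rewrite eq_sym.
have [tr _] := hbr; have [s [Gs sv]] := tr v1 v2 vv1 vv2 lv.
pose s' := invf s; have Gs' : G s' := subV sG Gs.
have ss' : cancel s s' := invfK sG Gs; have s's : cancel s' s := invfKV sG Gs.
pose theta x := mulf s (mulf x s'); pose theta' x := mulf s' (mulf x s).
have thM x y : theta (mulf x y) = mulf (theta x) (theta y).
  by apply: functional_extensionality => w; rewrite /theta /mulf ss'.
have thM' x y : theta' (mulf x y) = mulf (theta' x) (theta' y).
  by apply: functional_extensionality => w; rewrite /theta' /mulf s's.
have thG x : G x -> G (theta x) by move=> Gx; exact: (subM sG Gs (subM sG Gx Gs')).
have thG' x : G x -> G (theta' x) by move=> Gx; exact: (subM sG Gs' (subM sG Gx Gs)).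
have thr x : rist m G v1 x -> rist m G v2 (theta x).
  by move=> rx; rewrite -sv; exact: rist_conj.
have s'E : invf s' = s := invfV sG Gs.
have thr' x : rist m G v2 x -> rist m G v1 (theta' x).
  have -> : theta' x = mulf s' (mulf x (invf s')) by rewrite s'E.
  by move=> rx; rewrite -(ss' v1) sv; exact: rist_conj.
pose g2 := theta g1; have rg2 : rist m G v2 g2 := thr _ rg1.
have thg2 : theta' g2 = g1.
  by apply: functional_extensionality => w; rewrite /theta' /g2 /theta /mulf !ss'.
have disj12 w : in_subtree v1 w -> ~~ in_subtree v2 w by exact: in_subtree_disjoint.
have cm12 x y : rist m G v1 x -> rist m G v2 y -> mulf x y = mulf y x.
  exact: rist_commute.
have r1 := rist_subgroup sG v1; have r2 := rist_subgroup sG v2.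
pose C g := gen m (fun z => List.In z [:: g]).
have cyc v g : rist m G v g -> is_subgroup m (C g) /\ (forall x, C g x -> rist m G v x).
  move=> rg; have gr x : List.In x [:: g] -> rist m G v x by case=> [<-|[]].
  by split=> [|x]; [exact: gen_subgroup (rist_subgroup sG v) gr|exact: gen_sub (rist_subgroup sG v) gr].
have vr v g : rist m G v g -> virtual_retract m (C g) G.
  move=> rg; have [sC Cr] := cyc v g rg; apply: LR => //.
    by move=> x /Cr[].
  by apply: (fin_gen_list (A := G)) => // x [<-|[]]; case: rg.
have [sC1 Cr1] := cyc _ _ rg1; have [sC2 Cr2] := cyc _ _ rg2.
have [K1 [fK1 [CK1 [phi1 rphi1]]]] := vr _ _ rg1.
have [K2 [fK2 [CK2 [phi2 rphi2]]]] := vr _ _ rg2.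
have sK1 : is_subgroup m K1 by case: fK1.
have sK2 : is_subgroup m K2 by case: fK2.
pose R v (K : perm_fun -> Prop) x := rist m G v x /\ K x.
(* [R v K] has finite index in the finitely generated rist_G(v), so [schreier] applies. *)
have Rgens v K : vertex m v -> 0 < size v -> finite_index m K G -> exists t,
    (forall x, List.In x t -> R v K x) /\
    (forall x, R v K x -> gen m (fun z => List.In z t) x).
  move=> vv l0 fK; have rv := rist_subgroup sG v; have sK : is_subgroup m K by case: fK.
  apply: (fin_gen_gens (subgroupI rv sK)).
  apply: (schreier rv (rist_fin_gen sG hfg hbr vv l0)).
  by apply: (finite_indexI rv _ sG fK) => x [].
have [t1 [t1R t1gen]] := Rgens _ _ vv1 lv1 fK1.
have lv2 : 0 < size v2 by rewrite -lv.
have [t2 [t2R t2gen]] := Rgens _ _ vv2 lv2 fK2.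
pose D := in_fiber v1 v2 s s' K1 K2 phi1 phi2.
have sD : is_subgroup m D.
  exact: in_fiber_subgroup vv1 vv2 lv rg1 rg2 sK1 sK2 rphi1 rphi2 ss' s's.
have [t [tD tgen]] : exists t, (forall x, List.In x t -> D x) /\
    forall H, is_subgroup m H -> (forall x, List.In x t -> H x) ->
    forall u, vertex m u -> size u = n -> u != v1 -> u != v2 ->
    forall c, rist m G u c -> H c.
  apply: (level_gens (W := fun u H => u != v1 -> u != v2 -> forall c, rist m G u c -> H c)).
  move=> u vu lu; have [->|u1] := eqVneq u v1; first by exists nil.
  have [->|u2] := eqVneq u v2; first by exists nil.
  have ru := rist_subgroup sG u.
  have [|t [tr' tgen]] := fin_gen_gens ru (rist_fin_gen sG hfg hbr vu _); first by rewrite lu.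
  exists t; split=> [x /tr' rx|H sH tH _ _ c rc].
    exact: (in_fiber_out lv rg1 rg2 sK1 sK2 rphi1 rphi2 s's vu lu u1 u2 rx).
  exact: (tgen _ rc H sH tH).
pose ker (phi : perm_fun -> perm_fun) x := mulf x (invf (phi x)).
(* The diagonal element, the kernel parts of generators at [v1] and [v2], and generators at the
   other vertices. All lie in the fibre product, and [fiber_kernel] recovers both kernels from
   them. *)
pose S x := List.In x (mulf g1 g2 :: List.map (ker phi1) t1 ++ List.map (ker phi2) t2 ++ t).
have kerP v g K phi x : rist m G v g -> is_subgroup m K -> (forall x, C g x -> K x) ->
    retraction (C g) K phi -> R v K x ->
    [/\ rist m G v (ker phi x), K (ker phi x) & phi (ker phi x) = idf].
  move=> rg sK CK rphi [rx Kx]; have [sC Cr] := cyc _ _ rg.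
  have [phiM phiC phiid] := rphi; have Cx := phiC _ Kx; have Kpx := CK _ Cx.
  split; first exact: (subM (rist_subgroup sG v) rx (subV (rist_subgroup sG v) (Cr _ Cx))).
    exact: (subM sK Kx (subV sK Kpx)).
  rewrite /ker (phiM _ _ Kx (subV sK Kpx)) (retrV sC sK rphi Kpx) (phiid _ Cx).
  exact: mulfV sC Cx.
have SD x : S x -> D x.
  case=> [<-|]; first exact: (in_fiber_gen vv1 vv2 lv neq rg1 rg2 CK1 CK2 rphi1 rphi2).
  case/List.in_app_iff => [/List.in_map_iff[y [<- /t1R Ry]]|].
    have [ry Ky y1] := kerP _ _ _ _ _ rg1 sK1 CK1 rphi1 Ry.
    exact: (in_fiber1 vv1 lv neq rg2 sK2 rphi2 s's).
  case/List.in_app_iff => [/List.in_map_iff[y [<- /t2R Ry]]|/tD//].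
  have [ry Ky y1] := kerP _ _ _ _ _ rg2 sK2 CK2 rphi2 Ry.
  exact: (in_fiber2 vv2 lv neq rg1 sK1 rphi1 s's).
have DG x : D x -> G x by case=> -[].
have SG x : S x -> G x by move=> /SD/DG.
have sH := gen_subgroup sG SG; set H := gen m S in sH.
have HD x : H x -> D x := gen_sub sD SD.
have SH x : S x -> H x by exact: gen_in.
have RK v K : vertex m v -> is_subgroup m K -> is_subgroup m (R v K).
  by move=> vv; apply: subgroupI; exact: rist_subgroup.
have H12 : H (mulf g1 g2) by apply: SH; left.
have H1 : forall x, R v1 K1 x -> phi1 x = idf -> H x.
  apply: (fiber_kernel (theta := theta) (t := t1) sG r1 sK1 _ sH _ rg1 _ _ rphi1) => //.
  - exact: RK.
  - by move=> x [].
  - by move=> x [].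
  - by move=> x [].
  - by move=> x /Cr1[Gx _]; exact: thG.
  - by move=> x y rx /Cr1/thr; exact: cm12.
  - move=> x tx; apply: SH; right; apply/List.in_app_iff; left.
    by apply/List.in_map_iff; exists x.
(* The roles of [v1] and [v2] are exchanged; the diagonal element [g2 g1] is again [g1 g2], by
   disjoint supports. *)
have H2 : forall x, R v2 K2 x -> phi2 x = idf -> H x.
  apply: (fiber_kernel (theta := theta') (t := t2) sG r2 sK2 _ sH _ rg2 _ _ rphi2) => //.
  - exact: RK.
  - by move=> x [].
  - by move=> x [].
  - by move=> x [].
  - by move=> x /Cr2[Gx _]; exact: thG'.
  - by move=> x y rx /Cr2/thr' ry; symmetry; exact: cm12.
  - move=> x tx; apply: SH; right; apply/List.in_app_iff; right.
    by apply/List.in_app_iff; left; apply/List.in_map_iff; exists x.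
  - by rewrite thg2 -(cm12 _ _ rg1 rg2).
have Hout : forall u, vertex m u -> size u = n -> u != v1 -> u != v2 ->
    forall c, rist m G u c -> H c.
  apply: (tgen _ sH) => x tx; apply: SH; right.
  by apply/List.in_app_iff; right; apply/List.in_app_iff; right.
(* Finite index would put some [g1^(j - i)] with [i < j] in [H], hence in the fibre product, and so
   make it trivial. *)
have nfi : ~ finite_index m H G.
  move=> fH; have [Gg1 _] := rg1.
  have [i [j [ij Hij]]] := pigeonhole sG fH (fun k => sub_iter k sG Gg1).
  apply: (g1N1 (j - i)); first by rewrite subn_gt0.
  have Eij : mulf (invf (iter i g1)) (iter j g1) = iter (j - i) g1.
    apply: functional_extensionality => w; rewrite -{1}(subnKC (ltnW ij)) /mulf iterD.
    exact: (invfK sG (sub_iter i sG Gg1)).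
  rewrite Eij in Hij; have := HD _ Hij.
  exact: (in_fiber_power lv neq rg1 rg2 rphi1 rphi2 ss' s's).
have [||K [fK [HK [phi rphi]]]] := LR H sH.
- by move=> x /HD/DG.
- exact: fin_gen_list sG SG.
have sK : is_subgroup m K by case: fK.
have KG : forall x, K x -> G x by case: fK => _ [].
have [u [vu nu phi0]] := retraction_commf sH sK HK rphi n hm fK nfi.
have wu : in_subtree (take n u) u by rewrite /in_subtree size_takel.
have rw L x : (forall y, L y -> G y) -> rist m L u x -> rist m G (take n u) x.
  by move=> LG [Lx x1]; apply: (rist_mono wu); split=> //; exact: LG.
(* Commutators of rist_L(u) lying in [H] are both fixed and killed by [phi], whereas rist_L(u) is
   nonabelian. *)
have contra L : finite_index m L G -> (forall x, L x -> K x) ->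
    ~ forall x y, rist m L u x -> rist m L u y -> H (commf x y).
  move=> fL LK HL; have sL : is_subgroup m L by case: fL.
  have [|x [y [rx ry xy]]] := ristK_nonabelian hm sG hbr fL vu; first exact: leq_trans nu.
  apply: (commf_neq1 sL (rist_sub rx) (rist_sub ry) xy).
  have [_ _ phiid] := rphi; rewrite -(phiid _ (HL _ _ rx ry)).
  have inK z : rist m L u z -> rist m K u z by case=> /LK Kz z1; split.
  by apply: phi0; apply: inK.
have commC v g K' psi x y : rist m G v g -> is_subgroup m K' ->
    retraction (C g) K' psi -> K' x -> K' y -> psi (commf x y) = idf.
  move=> rg sK' rpsi Kx Ky; have [sC Cr] := cyc _ _ rg.
  have [psiM psiC _] := rpsi; apply: (retr_commf sC sK' rpsi Kx Ky).
  rewrite (psiM _ _ Kx Ky) (psiM _ _ Ky Kx).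
  exact: (cyclic_commute sG (rist_sub rg) (psiC _ Kx) (psiC _ Ky)).
(* For [u] below [v1] or [v2], take [L] to be the intersection of [K] and [K']: [psi] has cyclic
   image, so it kills the commutators, and the kernel of [psi] on [R v K'] lies in [H]. *)
have case12 v g K' psi : v = take n u -> rist m G v g -> finite_index m K' G ->
    retraction (C g) K' psi -> (forall x, R v K' x -> psi x = idf -> H x) -> False.
  move=> Ev rg fK' rpsi HR; have sK' : is_subgroup m K' by case: fK'.
  apply: (contra (fun x => K x /\ K' x)).
  - exact: (finite_index_trans sG fK (finite_indexI sK KG sG fK')).
  - by move=> x [].
  move=> x y rx ry; have [Kx Kx'] := rist_sub rx; have [Ky Ky'] := rist_sub ry.
  have LG z : K z /\ K' z -> G z by case=> /KG.
  apply: HR; last exact: (commC v g K' psi x y).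
  split; last exact: commf_in sK' Kx' Ky'.
  by apply: commf_in (rist_subgroup sG v) _ _; rewrite Ev; [exact: rw LG rx|exact: rw LG ry].
have [E|u1] := eqVneq (take n u) v1; first exact: (case12 v1 g1 K1 phi1).
have [E|u2] := eqVneq (take n u) v2; first exact: (case12 v2 g2 K2 phi2).
(* Below any other vertex of the level [H] contains the whole rigid stabilizer, so [L = K] works. *)
apply: (contra K) => // x y rx ry; apply: (Hout (take n u)) => //.
- exact: vertex_take.
- exact: size_takel.
exact: commf_in (rist_subgroup sG _) (rw _ _ KG rx) (rw _ _ KG ry).
Qed.
End Branch.
End InfiniteOrder.

Theorem theoremA (m : nat -> nat) (hm : forall n, 2 <= m n)
  (G : perm_fun -> Prop) (hG : is_subgroup m G) (hfg : fin_gen m G)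
  (hbr : is_branch m G) :
  ~ has_LR m G.
Proof.
have v0 : vertex m [:: 0] by apply: (@vertex_cat _ [::] [:: 0]).
have [g rg gN1] := rist_neq1 hm hG hbr v0 isT.
(* The order of this single [g] decides: if finite, [G] has torsion; if infinite, [g] serves as [g1]
   at the vertex [[:: 0]]. *)
have [[q q0 gq]|nt] := classic (exists2 q, 0 < q & iter q g = idf).
  exact: (torsion_not_LR hm hG hfg hbr (rist_sub rg) gN1 q0 gq).
apply: (infinite_order_not_LR hm hG hfg hbr v0 isT rg) => j j0 gj.
by apply: nt; exists j.
Qed.
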